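(* Let $\sigma\in(0,1/2)$, $\tilde B>0$, and let $b$ be the damping function $b(x,y)=0$ for $|x|\le\sigma$ and $b(x,y)=\tilde B$ for $\sigma<|x|\le1/2$. For any $\varepsilon>0$, the damped wave equation $$\partial_t^2u-\Delta u+b\,\partial_tu=0,\qquad(u,\partial_tu)|_{t=0}=(u_0,u_1),$$ on the torus $\mathbb{T}^2$ cannot be stable at the rate $\frac{1}{t^{2/3+\varepsilon}}$. The same result holds on the square $[-1/2,1/2]\times[0,1]$, with the same damping function, with Dirichlet or Neumann boundary conditions.
   Context: Here the torus $\mathbb{T}^2=(\mathbb{R}/\mathbb{Z})^2$ is identified with the square $\{-1/2\le x<1/2,\ 0\le y<1\}$ with periodic boundary conditions, with the flat metric. Let $A=-\Delta$ on $H=L^2$ with domain $D(A)=H^2(\mathbb{T}^2)$ on the torus, resp. the Dirichlet or Neumann Laplacian on the square. Let $\mathcal{A}(u_0,u_1)=(u_1,-Au_0-bu_1)$ with $D(\mathcal{A})=D(A)\times D(A^{1/2})$, and $|(u_0,u_1)|_{\mathcal{H}}^2=\|A^{1/2}u_0\|_{L^2}^2+\|u_1\|_{L^2}^2$. The energy is $E(u,t)=\frac12\big(\|A^{1/2}u(t)\|_{L^2}^2+\|\partial_tu(t)\|_{L^2}^2\big)$. The equation is stable at rate $f(t)$ (where $f(t)\to0$ as $t\to+\infty$) if there exists $C>0$ such that for all $(u_0,u_1)\in D(\mathcal{A})$ and all $t>0$, $E(u,t)^{1/2}\le Cf(t)\,|\mathcal{A}(u_0,u_1)|_{\mathcal{H}}$.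 *)

(* Defs.v *)
(* MathComp-Analysis, with complex numbers R[i] over an arbitrary R : realType. *)
From HB Require Import structures.
From mathcomp Require Import all_boot all_order all_algebra.
From mathcomp Require Import complex.
From mathcomp Require Import all_classical all_reals all_analysis.

Set Implicit Arguments.
Unset Strict Implicit.
Unset Printing Implicit Defensive.
Import Order.TTheory GRing.Theory Num.Theory.
Import numFieldNormedType.Exports.
Local Open Scope classical_set_scope.
Local Open Scope ring_scope.

Definition field_on_plane (R : realType) : Type := R * R -> R[i].

(* The square, which is also the fundamental cell of the torus: its sides are
   null sets, so it does not matter which of them are included.  A function on
   the torus is given by its values on the cell; periodicity enters through the
   periodic test functions below.  All notions below depend only on the classes
   of functions modulo almost everywhere equality on the cell. *)
Definition cell (R : realType) : set (R * R) :=
  `[- 2^-1, 2^-1]%classic `*` `[0, 1]%classic.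

Definition open_cell (R : realType) : set (R * R) :=
  `]- 2^-1, 2^-1[%classic `*` `]0, 1[%classic.

Arguments cell : clear implicits.
Arguments open_cell : clear implicits.

Notation leb2 R := (@lebesgue_measure R \x @lebesgue_measure R)%E.

Definition ae_eq_cell (R : realType) (u v : field_on_plane R) : Prop :=
  {ae leb2 R, forall p, cell R p -> u p = v p}.

Definition sqmod (R : realType) (z : R[i]) : R :=
  complex.Re z ^+ 2 + complex.Im z ^+ 2.

Definition cintegral (R : realType) (u : field_on_plane R) : R[i] :=
  Complex (\int[leb2 R]_(p in cell R) complex.Re (u p))
          (\int[leb2 R]_(p in cell R) complex.Im (u p)).

Definition L2 (R : realType) (u : field_on_plane R) : Prop :=
  [/\ measurable_fun (cell R) (fun p => complex.Re (u p)),
      measurable_fun (cell R) (fun p => complex.Im (u p)) &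
      (leb2 R).-integrable (cell R) (fun p => (sqmod (u p))%:E)].

Definition inner (R : realType) (u v : field_on_plane R) : R[i] :=
  cintegral (fun p => u p * conjc (v p)).

Definition L2norm (R : realType) (u : field_on_plane R) : R :=
  Num.sqrt (\int[leb2 R]_(p in cell R) sqmod (u p)).

(* [C1 phi phi1 phi2]: phi is of class C^1 on the plane, with partial
   derivatives phi1 and phi2. *)
Definition C1 (R : realType) (phi phi1 phi2 : R * R -> R) : Prop :=
  [/\ continuous phi, continuous phi1, continuous phi2,
      (forall x y : R, is_derive x 1 (fun s => phi (s, y)) (phi1 (x, y))) &
      (forall x y : R, is_derive y 1 (fun s => phi (x, s)) (phi2 (x, y)))].

Definition torus_test (R : realType) (phi : R * R -> R) : Prop :=
  forall x y : R, phi (x + 1, y) = phi (x, y) /\ phi (x, y + 1) = phi (x, y).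

(* The cell being bounded, such a support is compact. *)
Definition compact_test (R : realType) (phi : R * R -> R) : Prop :=
  closure [set p | phi p != 0] `<=` open_cell R.

(* [weak_grad T u g1 g2]: u has weak gradient (g1, g2) in L^2, tested against
   the C^1 functions in T.  Together with C^1_c test functions this is the
   usual H^1 of the open square, with periodic ones it is H^1 of the torus. *)
Definition weak_grad (R : realType) (T : (R * R -> R) -> Prop)
    (u g1 g2 : field_on_plane R) : Prop :=
  [/\ L2 u, L2 g1, L2 g2 &
   forall phi phi1 phi2, C1 phi phi1 phi2 -> T phi ->
     cintegral (fun p => u p * Complex (phi1 p) 0)
       = - cintegral (fun p => g1 p * Complex (phi p) 0) /\
     cintegral (fun p => u p * Complex (phi2 p) 0)
       = - cintegral (fun p => g2 p * Complex (phi p) 0)].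

(* u is in H^2, with gradient (g1, g2) and Hessian (g11, g12; g21, g22). *)
Definition weak_H2 (R : realType) (T : (R * R -> R) -> Prop)
    (u g1 g2 g11 g12 g21 g22 : field_on_plane R) : Prop :=
  [/\ weak_grad T u g1 g2, weak_grad T g1 g11 g12 & weak_grad T g2 g21 g22].

(* u, with gradient (g1, g2), is in the H^1 closure of C^1_c. *)
Definition H10 (R : realType) (u g1 g2 : field_on_plane R) : Prop :=
  forall e : R, 0 < e ->
  exists phi phi1 phi2 psi psi1 psi2 : R * R -> R,
  [/\ C1 phi phi1 phi2 /\ C1 psi psi1 psi2,
      compact_test phi /\ compact_test psi &
   [/\ L2norm (fun p => u p - Complex (phi p) (psi p)) < e,
       L2norm (fun p => g1 p - Complex (phi1 p) (psi1 p)) < e &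
       L2norm (fun p => g2 p - Complex (phi2 p) (psi2 p)) < e]].

(* The normal derivative of u, with gradient (g1, g2) and Laplacian l, has zero
   trace: by Green's formula,
   int_cell (l phi + grad u . grad phi) = int_boundary (d_n u) phi. *)
Definition zero_normal_derivative (R : realType)
    (g1 g2 l : field_on_plane R) : Prop :=
  forall phi phi1 phi2 : R * R -> R, C1 phi phi1 phi2 ->
    cintegral (fun p => l p * Complex (phi p) 0 +
      (g1 p * Complex (phi1 p) 0 + g2 p * Complex (phi2 p) 0)) = 0.

(* Unbounded operators on L^2 are given by their graphs: [A u f] means that u
   is in D(A) and A u = f. *)
Definition operator (R : realType) : Type :=
  field_on_plane R -> field_on_plane R -> Prop.

(* A = - Delta with D(A) = H^2 of the torus. *)
Definition torus_laplacian (R : realType) : operator R := fun u f =>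
  exists g1 g2 g11 g12 g21 g22 : field_on_plane R,
  [/\ weak_H2 (@torus_test R) u g1 g2 g11 g12 g21 g22, L2 f &
      ae_eq_cell f (fun p => - (g11 p + g22 p))].

(* A = - Delta with D(A) = H^2 /\ H^1_0 of the square. *)
Definition dirichlet_laplacian (R : realType) : operator R := fun u f =>
  exists g1 g2 g11 g12 g21 g22 : field_on_plane R,
  [/\ weak_H2 (@compact_test R) u g1 g2 g11 g12 g21 g22, H10 u g1 g2, L2 f &
      ae_eq_cell f (fun p => - (g11 p + g22 p))].

(* A = - Delta with D(A) = {u in H^2 of the square | d_n u = 0}. *)
Definition neumann_laplacian (R : realType) : operator R := fun u f =>
  exists g1 g2 g11 g12 g21 g22 : field_on_plane R,
  [/\ weak_H2 (@compact_test R) u g1 g2 g11 g12 g21 g22,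
      zero_normal_derivative g1 g2 (fun p => g11 p + g22 p), L2 f &
      ae_eq_cell f (fun p => - (g11 p + g22 p))].

(* S is equal to its adjoint.  Density of D(S) is not a separate condition: for
   S = S^*, it amounts to S being single-valued almost everywhere, which holds
   in [is_sqrt] because A is. *)
Definition selfadjoint (R : realType) (S : operator R) : Prop :=
  forall v g, S v g <->
    [/\ L2 v, L2 g & forall u f, S u f -> inner f v = inner u g].

(* S = A^{1/2}: the nonnegative self-adjoint operator with S o S = A, domains
   included.  It exists and is unique for A nonnegative and self-adjoint. *)
Definition is_sqrt (R : realType) (A S : operator R) : Prop :=
  [/\ selfadjoint S,
      (forall u f, S u f -> 0 <= inner f u) &
      (forall u f, A u f <-> exists2 g, S u g & S g f)].

Section DampedWave.
Variable R : realType.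

Definition L2_continuous (w : R -> field_on_plane R) : Prop :=
  forall t : R, 0 <= t -> forall e : R, 0 < e ->
    \forall s \near within [set s | 0 <= s] (nbhs t),
      L2norm (fun p => w s p - w t p) <= e.

(* w is the derivative of v on [0, +oo[, one-sided at 0, in L^2. *)
Definition L2_derivative (v w : R -> field_on_plane R) : Prop :=
  forall t : R, 0 <= t -> forall e : R, 0 < e ->
    \forall s \near within [set s | 0 <= s] (nbhs t),
      L2norm (fun p => v s p - v t p - Complex (s - t) 0 * w t p)
        <= e * `|s - t|.

(* The solution (u, v) = (u, d_t u) of the first-order system: it is in D(A) x
   D(S) at all times, it is C^1 on [0, +oo[ with values in D(S) x L^2, D(S)
   having the graph norm, and its derivative is (v, - A u - b v).  Here
   a = A u, q = S u, r = S v for S = A^{1/2}. *)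
Definition solution (A S : operator R) (b : R * R -> R)
    (u0 u1 : field_on_plane R) (u v : R -> field_on_plane R) : Prop :=
  exists a q r : R -> field_on_plane R,
  let w t := fun p => - a t p - Complex (b p) 0 * v t p in
  [/\ (forall t, 0 <= t -> [/\ A (u t) (a t), S (u t) (q t) & S (v t) (r t)]),
      [/\ L2_derivative u v, L2_derivative q r & L2_derivative v w],
      [/\ L2_continuous v, L2_continuous r & L2_continuous w] &
      ae_eq_cell (u 0) u0 /\ ae_eq_cell (v 0) u1].

(* The energy, as a function of q = A^{1/2} u and of v = d_t u. *)
Definition energy (q v : field_on_plane R) : R :=
  2^-1 * (L2norm q ^+ 2 + L2norm v ^+ 2).

(* The norm |(u1, - A u0 - b u1)| with a0 = A u0 and r1 = A^{1/2} u1. *)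
Definition generator_norm (b : R * R -> R) (a0 u1 r1 : field_on_plane R) : R :=
  Num.sqrt (L2norm r1 ^+ 2 +
            L2norm (fun p => - a0 p - Complex (b p) 0 * u1 p) ^+ 2).

(* Stability at rate f, where S = A^{1/2}. *)
Definition stable_at_rate (A S : operator R) (b : R * R -> R) (f : R -> R) :
    Prop :=
  exists2 C : R, 0 < C &
  forall u0 u1 a0 r1 : field_on_plane R, A u0 a0 -> S u1 r1 ->
  forall u v : R -> field_on_plane R, solution A S b u0 u1 u v ->
  forall (t : R) (q : field_on_plane R), 0 < t -> S (u t) q ->
    Num.sqrt (energy q (v t)) <= C * f t * generator_norm b a0 u1 r1.

(* On the cell, where |x| <= 1/2. *)
Definition damping (sigma B : R) : R * R -> R :=
  fun p => if `|p.1| <= sigma then 0 else B.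

End DampedWave.

(* Main.v *)
Require Import Defs.
From HB Require Import structures.
From mathcomp Require Import all_boot all_order all_algebra.
From mathcomp Require Import complex ring lra.
From mathcomp Require Import all_classical all_reals all_analysis measurable_realfun.

(* The modes that are even in x and supported on one frequency nu = 2 pi n in y
   solve a transcendental equation: for u(t, x, y) = exp(z t) X(x) Y(y), X is a
   combination of exp(+- i k x) in the undamped strip and of exp(+- kap x)
   outside of it, with z^2 = -(nu^2 + k^2) and kap^2 = B z - k^2, and X is C^1
   across |x| = sigma.  As nu tends to infinity, z is close to i nu and kap to
   (i B nu)^(1/2), so that the strong damping almost imposes a Dirichlet
   condition at |x| = sigma: a contraction argument yields a solution with
   k sigma = pi / 2 + O(nu^(-1/2)), hence with Im k^2 = O(nu^(-1/2)) and
   Re z = O(nu^(-3/2)).  At time t = nu^(3/2) this mode has kept a fixed fraction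
   of its energy, which a decay at rate t^(-2/3 - eps), with the loss of one
   derivative nu = t^(2/3), does not allow. *)

Set Implicit Arguments.
Unset Strict Implicit.
Unset Printing Implicit Defensive.
Import Order.TTheory GRing.Theory Num.Theory numFieldNormedType.Exports.
Local Open Scope classical_set_scope.
Local Open Scope ring_scope.

(** * The complex exponential *)

(** The damping jumps at |x| = sigma, so the second x-derivative of a mode is only piecewise
    continuous: membership in H^2 is proved weakly, by integrating by parts on each smooth piece and
    letting the interface terms cancel. The operator S is known only through the axioms of
    [is_sqrt], and nothing is computed about it: when A u = a, they give g with S u = g and S g = a,
    and the norm of g enters the energy and the initial norm through one common factor, which
    cancels. Evenness in x lets one parameter [tau] treat all boundary conditions: with [tau] = 1
    the mode is Neumann in x and, being even, also periodic, so that the torus and the Neumann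
    square share it; with [tau] = -1 it is Dirichlet. Only the factor in y changes, a cosine or a
    sine, at the same frequencies in the three cases. The decay rate gains a power of nu because the
    limit of k is the real number pi / (2 sigma): Im k^2 comes from the first correction alone. *)

Section CExp.
Variable R : realType.
Implicit Types (z w : R[i]) (x y : R).

(** A real-valued norm without square roots, submultiplicative like the modulus, whose estimates
    reduce to polynomial inequalities between absolute values of coordinates. *)
Definition l1 z : R := `|complex.Re z| + `|complex.Im z|.

Lemma l1_ge0 z : 0 <= l1 z.
Proof. by rewrite addr_ge0. Qed.

Lemma l1N z : l1 (- z) = l1 z.
Proof. by case: z => a b; rewrite /l1 /= !normrN. Qed.

Lemma l1D z w : l1 (z + w) <= l1 z + l1 w.
Proof.
case: z w => [a b] [c d]; rewrite /l1 /=.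
by have := ler_normD a c; have := ler_normD b d; lra.
Qed.

Lemma l1B z w : l1 (z - w) <= l1 z + l1 w.
Proof. by rewrite -(l1N w) l1D. Qed.

Lemma l1M z w : l1 (z * w) <= l1 z * l1 w.
Proof.
case: z w => [a b] [c d]; rewrite /l1 /=.
have := ler_normB (a * c) (b * d); have := ler_normD (a * d) (b * c).
by rewrite !normrM; lra.
Qed.

Lemma l1_real x : l1 (x%:C)%C = `|x|.
Proof. by rewrite /l1 /= normr0 addr0. Qed.

Definition cexp z : R[i] :=
  Complex (expR (complex.Re z) * cos (complex.Im z))
          (expR (complex.Re z) * sin (complex.Im z)).

Lemma cexpD z w : cexp (z + w) = cexp z * cexp w.
Proof.
case: z w => [a b] [c d]; apply/eqP; rewrite eq_complex /=.
by rewrite expRD cosD sinD; apply/andP; split; apply/eqP; ring.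
Qed.

Lemma cexp0 : cexp 0 = 1.
Proof. by apply/eqP; rewrite eq_complex /= expR0 cos0 sin0 mulr1 mulr0 !eqxx. Qed.

Lemma cexpNK z : cexp z * cexp (- z) = 1.
Proof. by rewrite -cexpD subrr cexp0. Qed.

Lemma cexp_neq0 z : cexp z != 0.
Proof.
by apply/eqP => h; have := cexpNK z; rewrite h mul0r => /eqP; rewrite eq_sym oner_eq0.
Qed.

Lemma normr_sub0_le (f f' : R -> R) (M y : R) :
  (forall x, is_derive x 1 f (f' x)) ->
  (forall x, `|x| <= `|y| -> `|f' x| <= M) -> `|f y - f 0| <= M * `|y|.
Proof.
move=> df f'M.
have cf (A : set R) : {within A, continuous f}.
  apply: continuous_subspaceT => x.
  by apply/differentiable_continuous/derivable1_diffP; have [] := df x.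
have [y0|y0] := leP 0 y.
- have [c] := MVT_segment y0 (fun x _ => df x) (cf _).
  rewrite in_itv /= subr0 => /andP[c0 cy] ->.
  by rewrite normrM ler_wpM2r// f'M// !ger0_norm.
- have [c] := MVT_segment (ltW y0) (fun x _ => df x) (cf _).
  rewrite in_itv /= sub0r => /andP[c0 cy]; rewrite distrC => ->.
  by rewrite normrM normrN ler_wpM2r// f'M// !ler0_norm ?lerN2// ltW.
Qed.

Lemma normr_sin_le y : `|sin y| <= `|y|.
Proof.
have := @normr_sub0_le sin cos 1 y (fun x => is_derive_sin x).
by rewrite sin0 subr0 mul1r; apply => x _; rewrite ler_norml cos_geN1 cos_le1.
Qed.

Lemma cosB1_le y : `|cos y - 1| <= y ^+ 2 / 2.
Proof.
have -> : cos y = 1 - 2 * sin (y / 2) ^+ 2.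
  have -> : cos y = cos (y / 2 + y / 2) by congr cos; lra.
  by rewrite cosD; have := cos2Dsin2 (y / 2); lra.
have := normr_sin_le (y / 2); rewrite -ler_sqr ?nnegrE// !real_normK ?num_real//.
have := sqr_ge0 (sin (y / 2)); set s := sin _ ^+ 2 => s0 sy.
rewrite addrAC subrr add0r normrN ger0_norm; last lra.
by move: sy; rewrite exprMn; lra.
Qed.

Lemma sinB_le y : `|y| <= 1 -> `|sin y - y| <= y ^+ 2.
Proof.
move=> y1.
have df x : is_derive x 1 (fun t : R => sin t - t) (cos x - 1) by exact: is_derive_eq.
have := @normr_sub0_le _ _ `|y| y df.
rewrite sin0 !subr0 -expr2 real_normK ?num_real//; apply => x xy.
apply: (le_trans (cosB1_le x)).
rewrite -(real_normK (num_real x)).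
have := normr_ge0 x; nra.
Qed.

(** The tangent bound at x gives the lower estimate. At -x it gives 1 - x <= exp(-x) = 1 / exp(x),
    hence the upper one. *)
Lemma expRB1_le x : `|x| <= 2^-1 -> `|expR x - 1 - x| <= 2 * x ^+ 2.
Proof.
rewrite ler_norml => /andP[xl xu]; have := expR_ge1Dx x; have := expR_ge1Dx (- x).
have := expRxMexpNx_1 x; have := expR_gt0 x.
set e := expR x; set e' := expR _ => e0 ee e'x ex.
rewrite ger0_norm; last by lra.
have : e * (1 - x) <= e * e' by rewrite ler_pM2l//; lra.
rewrite ee; nra.
Qed.

Lemma cexp_quad z : l1 z <= 2^-1 -> l1 (cexp z - 1 - z) <= 8 * l1 z ^+ 2.
Proof.
case: z => x y; rewrite /l1 /= !subr0 => h.
have hx := normr_ge0 x; have hy := normr_ge0 y.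
have x2 : `|x| <= 2^-1 by lra.
have ex := expRB1_le x2.
have cy := cosB1_le y; have y1 : `|y| <= 1 by lra.
have sy := sinB_le y1; have sy' := normr_sin_le y.
have e1 : `|expR x - 1| <= 2 * `|x|.
  have -> : expR x - 1 = (expR x - 1 - x) + x by ring.
  apply: (le_trans (ler_normD _ _)); move: ex.
  rewrite -(real_normK (num_real x)); nra.
have e2 : `|expR x| <= 2.
  have -> : expR x = (expR x - 1) + 1 by ring.
  by apply: (le_trans (ler_normD _ _)); rewrite normr1; lra.
have -> : expR x * cos y - 1 - x = (expR x - 1 - x) + expR x * (cos y - 1) by ring.
have -> : expR x * sin y - y = (expR x - 1) * sin y + (sin y - y) by ring.
have := ler_normD (expR x - 1 - x) (expR x * (cos y - 1)).
have := ler_normD ((expR x - 1) * sin y) (sin y - y).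
rewrite !normrM.
have : `|expR x - 1| * `|sin y| <= 2 * `|x| * `|y| by rewrite ler_pM.
have : `|expR x| * `|cos y - 1| <= 2 * (y ^+ 2 / 2) by rewrite ler_pM.
move: ex sy; rewrite -(real_normK (num_real x)) -(real_normK (num_real y)).
nra.
Qed.
End CExp.

(** * A quantitative fixed point theorem *)

HB.instance Definition _ (R : realType) (m n : nat) :=
  Complete.on 'M[R]_(m.+1, n.+1).

(** The sum has Lipschitz constant 1/4 + d L <= 1/2 and maps the ball of radius r to itself. The
    final bound, obtained from |x| <= |x| / 4 + d L, matters as much as existence: it says that the
    corrections to the limit problem have size d. *)
Lemma perturbed_contraction_fixpoint (R : realType) (V : completeNormedModType R)
    (G0 H : V -> V) (r d L : R) :
  0 < r -> 0 <= d -> 0 <= L -> d * L <= r / 4 -> d * L <= 1 / 4 ->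
  G0 0 = 0 ->
  (forall x y, `|x| <= r -> `|y| <= r -> `|G0 x - G0 y| <= 4^-1 * `|x - y|) ->
  (forall x, `|x| <= r -> `|H x| <= L) ->
  (forall x y, `|x| <= r -> `|y| <= r -> `|H x - H y| <= L * `|x - y|) ->
  exists2 x, x = G0 x + d *: H x & `|x| <= 2 * (d * L).
Proof.
move=> r0 d0 L0 dLr dL1 G00 G0c HL Hc.
have G0r x : `|x| <= r -> `|G0 x| <= 4^-1 * `|x|.
  by move=> xr; have := G0c x 0 xr; rewrite normr0 G00 !subr0; apply; exact: ltW.
have Hr x : `|x| <= r -> `|d *: H x| <= d * L.
  by move=> xr; rewrite normrZ (ger0_norm d0) ler_wpM2l// HL.
pose U := [set x : V | `|x| <= r].
have GU : {homo (fun x => G0 x + d *: H x) : x / U x >-> U x}.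
  move=> x; rewrite /U /= => xr; apply: (le_trans (ler_normD _ _)).
  by have := G0r _ xr; have := Hr _ xr; lra.
have [|||x Ux xE] := @banach_fixed_point _ V U [fun of mkfun GU].
- have q0 : (0 : R) <= 2^-1 by lra.
  exists (NngNum q0); split => /=; first lra.
  move=> -[x y] [/= Ux Uy].
  have -> : G0 x + d *: H x - (G0 y + d *: H y) = (G0 x - G0 y) + d *: (H x - H y).
    by rewrite scalerBr opprD addrACA.
  apply: (le_trans (ler_normD _ _)); rewrite normrZ (ger0_norm d0).
  have h1 := G0c _ _ Ux Uy.
  have h2 : d * `|H x - H y| <= 1 / 4 * `|x - y|.
    apply: (le_trans (ler_wpM2l d0 (Hc _ _ Ux Uy))).
    by rewrite mulrA ler_wpM2r.
  lra.
- have -> : U = (fun x : V => `|x|) @^-1` [set t : R | t <= r] by [].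
  by apply: preimage_closed; [move=> ? _; exact: norm_continuous|exact: closed_le].
- by exists 0; rewrite /U /= normr0 ltW.
exists x => //.
have : `|x| <= 4^-1 * `|x| + d * L.
  rewrite {1}xE /=; apply: (le_trans (ler_normD _ _)).
  by have := G0r _ Ux; have := Hr _ Ux; lra.
by have := mulr_ge0 d0 L0; lra.
Qed.

(** * Lipschitz bounds for the complex exponential and sine *)

Section CExpLipschitz.
Variable R : realType.
Implicit Types (a b z : R[i]) (L : R).

Lemma l1_cexp_le z L : l1 z <= L -> l1 (cexp z) <= 2 * expR L.
Proof.
move=> zL; rewrite /l1 /= !normrM ger0_norm ?expR_ge0//.
have : expR (complex.Re z) <= expR L.
  rewrite ler_expR (le_trans _ zL)// (le_trans (ler_norm _))//.
  by rewrite /l1 lerDl.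
have := expR_ge0 (complex.Re z).
have : `|cos (complex.Im z)| <= 1 by rewrite ler_norml cos_geN1 cos_le1.
have : `|sin (complex.Im z)| <= 1 by rewrite ler_norml sin_geN1 sin_le1.
nra.
Qed.

(** For distant points the sum of the two moduli is already small enough compared with |a - b|. For
    close ones, factoring out exp b leaves exp(a - b) - 1, which is at most 5 |a - b| by the
    quadratic estimate. *)
Lemma l1_cexpB_le a b L : l1 a <= L -> l1 b <= L ->
  l1 (cexp a - cexp b) <= 10 * expR L * l1 (a - b).
Proof.
move=> aL bL; have ea := l1_cexp_le aL; have eb := l1_cexp_le bL.
have e0 := expR_ge0 L; have d0 := l1_ge0 (a - b).
have [d1|d1] := leP (l1 (a - b)) 2^-1; last first.
  by apply: (le_trans (l1B _ _)); nra.
have -> : cexp a - cexp b =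
    cexp b * ((cexp (a - b) - 1 - (a - b)) + (a - b)).
  have {1}-> : a = b + (a - b) by ring.
  by rewrite cexpD; ring.
apply: (le_trans (l1M _ _)).
have := l1D (cexp (a - b) - 1 - (a - b)) (a - b).
have := cexp_quad d1; set q := l1 (_ + (a - b)).
have := l1_ge0 (cexp b); have : 0 <= q by exact: l1_ge0.
move=> q0 b0 qq qd; apply: (@le_trans _ _ (2 * expR L * q)); first exact: ler_wpM2r.
have : q <= 5 * l1 (a - b) by nra.
nra.
Qed.

(** The difference is exp b (exp(a - b) - 1 - (a - b)) + (exp b - 1) (a - b). Since |a - b| <= 2
    rho, the first term contributes 2 * 8 * 2 rho = 32 rho and the second 3 rho. *)
Lemma l1_cexpB1_le a b (rho : R) : rho <= 4^-1 -> l1 a <= rho -> l1 b <= rho ->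
  l1 ((cexp a - 1 - a) - (cexp b - 1 - b)) <= 35 * rho * l1 (a - b).
Proof.
move=> r4 ar br; have h := l1B a b; have b0 := l1_ge0 b; have d0 := l1_ge0 (a - b).
have d2 : l1 (a - b) <= 2^-1 by lra.
have b2 : l1 b <= 2^-1 by lra.
have qd := cexp_quad d2; have qb := cexp_quad b2.
have -> : (cexp a - 1 - a) - (cexp b - 1 - b) =
    cexp b * (cexp (a - b) - 1 - (a - b)) + (cexp b - 1) * (a - b).
  have {1}-> : a = b + (a - b) by ring.
  by rewrite cexpD; ring.
have eb1 : l1 (cexp b - 1) <= 3 * l1 b.
  have -> : cexp b - 1 = (cexp b - 1 - b) + b by ring.
  by apply: (le_trans (l1D _ _)); nra.
have eb : l1 (cexp b) <= 2.
  have -> : cexp b = (cexp b - 1) + 1 by ring.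
  apply: (le_trans (l1D _ _)).
  have -> : l1 (1 : R[i]) = 1 by rewrite /l1 /= normr0 normr1 addr0.
  by lra.
apply: (le_trans (l1D _ _)).
have : l1 (cexp b * (cexp (a - b) - 1 - (a - b))) <= 2 * (8 * l1 (a - b) ^+ 2).
  by apply: (le_trans (l1M _ _)); rewrite ler_pM// l1_ge0.
have : l1 ((cexp b - 1) * (a - b)) <= 3 * l1 b * l1 (a - b).
  by apply: (le_trans (l1M _ _)); rewrite ler_wpM2r.
nra.
Qed.

Definition csin z : R[i] := - ('i%C / 2) * (cexp ('i%C * z) - cexp (- ('i%C * z))).
Definition ccos z : R[i] := (cexp ('i%C * z) + cexp (- ('i%C * z))) / 2.

Lemma l1_i : l1 ('i%C : R[i]) = 1.
Proof. by rewrite /l1 /= normr0 normr1 add0r. Qed.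

Lemma l1_half : l1 (2^-1 : R[i]) = 2^-1.
Proof.
have -> : (2^-1 : R[i]) = (2^-1 : R)%:C%C by rewrite rmorphV ?unitfE//= rmorph_nat.
by rewrite l1_real ger0_norm.
Qed.

(** a - sin a is i / 2 times the difference of the remainders exp w - 1 - w at w = i a and w = - i
    a, so the constant of the exponential is not increased. *)
Lemma l1_csinB_le a b (rho : R) : rho <= 4^-1 -> l1 a <= rho -> l1 b <= rho ->
  l1 ((a - csin a) - (b - csin b)) <= 35 * rho * l1 (a - b).
Proof.
move=> r4 ar br.
have li z : l1 ('i%C * z) <= l1 z.
  by apply: (le_trans (l1M _ _)); rewrite l1_i mul1r.
have lN z : l1 (- ('i%C * z)) <= l1 z by rewrite l1N.
have h1 := l1_cexpB1_le r4 (le_trans (li a) ar) (le_trans (li b) br).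
have h2 := l1_cexpB1_le r4 (le_trans (lN a) ar) (le_trans (lN b) br).
have r0 : 0 <= rho by rewrite (le_trans (l1_ge0 a)).
have h3 : l1 ('i%C * a - 'i%C * b) <= l1 (a - b) by rewrite -mulrBr.
have h4 : l1 (- ('i%C * a) - - ('i%C * b)) <= l1 (a - b) by rewrite -opprD l1N.
set X := l1 _ in h1; set Y := l1 _ in h2.
have hX : X <= 35 * rho * l1 (a - b).
  by apply: (le_trans h1); rewrite ler_wpM2l//; lra.
have hY : Y <= 35 * rho * l1 (a - b).
  by apply: (le_trans h2); rewrite ler_wpM2l//; lra.
have ii : 'i%C * 'i%C = -1 :> R[i] by rewrite -expr2 sqr_i.
have -> : (a - csin a) - (b - csin b) = 'i%C / 2 *
   (((cexp ('i%C * a) - 1 - 'i%C * a) - (cexp ('i%C * b) - 1 - 'i%C * b)) -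
    ((cexp (- ('i%C * a)) - 1 - - ('i%C * a)) -
     (cexp (- ('i%C * b)) - 1 - - ('i%C * b)))).
  apply/eqP; rewrite -subr_eq0; apply/eqP; rewrite /csin.
  transitivity ((a - b) * (1 + 'i%C * 'i%C) : R[i]); last by rewrite ii subrr mulr0.
  by field.
apply: (le_trans (l1M _ _)).
have : l1 ('i%C / 2 : R[i]) <= 2^-1.
  by apply: (le_trans (l1M _ _)); rewrite l1_i l1_half mul1r.
have := l1B ((cexp ('i%C * a) - 1 - 'i%C * a) - (cexp ('i%C * b) - 1 - 'i%C * b))
  ((cexp (- ('i%C * a)) - 1 - - ('i%C * a)) - (cexp (- ('i%C * b)) - 1 - - ('i%C * b))).
rewrite -/X -/Y; set Z := l1 (_ - _); set I2 := l1 ('i%C / 2) => hZ hI.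
have : 0 <= Z by exact: l1_ge0.
have : 0 <= I2 by exact: l1_ge0.
nra.
Qed.
End CExpLipschitz.

(** * Functions bounded and Lipschitz uniformly in a parameter *)

Section UniformLipschitz.
Variables (R : realType) (V : normedModType R) (T : Type).
Implicit Types (f g : T -> V -> R[i]).

(** The parameter will be the frequency. The constant is chosen before it, so that one [L] serves
    all frequencies and the factor nu^(-1/2) in front of the perturbation can beat it. Both bounds
    are carried together because products and exponentials need both. *)
Definition ulip f := exists2 L : R, 0 <= L &
  forall t x y, `|x| <= 1 -> `|y| <= 1 ->
    l1 (f t x) <= L /\ l1 (f t x - f t y) <= L * `|x - y|.

Lemma ulip_cst (c : T -> R[i]) (L : R) :
  (forall t, l1 (c t) <= L) -> ulip (fun t _ => c t).
Proof.
(* When [T] is empty, the hypothesis does not force [L] to be nonnegative. *)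
move=> cL; exists (Num.max L 0); first by rewrite le_max lexx orbT.
move=> t x y _ _; rewrite subrr /l1 normr0 addr0 le_max cL; split => //.
by rewrite mulr_ge0// le_max lexx orbT.
Qed.

Lemma ulip_const (c : R[i]) : ulip (fun _ _ => c).
Proof. exact: (@ulip_cst (fun=> c) (l1 c)). Qed.

Lemma ulipD f g : ulip f -> ulip g -> ulip (fun t x => f t x + g t x).
Proof.
move=> [L L0 fL] [M M0 gM]; exists (L + M); first exact: addr_ge0.
move=> t x y x1 y1; have [f1 f2] := fL t _ _ x1 y1; have [g1 g2] := gM t _ _ x1 y1.
split; first by apply: (le_trans (l1D _ _)); exact: lerD.
have -> : f t x + g t x - (f t y + g t y) = (f t x - f t y) + (g t x - g t y) by ring.
by apply: (le_trans (l1D _ _)); rewrite mulrDl lerD.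
Qed.

Lemma ulipM f g : ulip f -> ulip g -> ulip (fun t x => f t x * g t x).
Proof.
move=> [L L0 fL] [M M0 gM]; exists (2 * (L * M)); first by rewrite !mulr_ge0.
move=> t x y x1 y1; have [f1 f2] := fL t _ _ x1 y1; have [g1 g2] := gM t _ _ x1 y1.
have [f3 _] := fL t _ _ y1 y1.
have LM := mulr_ge0 L0 M0.
split.
  apply: (le_trans (l1M _ _)); apply: (@le_trans _ _ (L * M)); last by lra.
  by rewrite ler_pM// l1_ge0.
have -> : f t x * g t x - f t y * g t y =
  (f t x - f t y) * g t x + f t y * (g t x - g t y) by ring.
apply: (le_trans (l1D _ _)); have -> : 2 * (L * M) * `|x - y| =
  L * `|x - y| * M + L * (M * `|x - y|) by ring.
by rewrite lerD// (le_trans (l1M _ _))// ler_pM// l1_ge0.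
Qed.

Lemma ulipN f : ulip f -> ulip (fun t x => - f t x).
Proof.
move=> [L L0 fL]; exists L => // t x y x1 y1; have [f1 f2] := fL t _ _ x1 y1.
by rewrite -opprD !l1N.
Qed.

Lemma ulip_cexp f : ulip f -> ulip (fun t x => cexp (f t x)).
Proof.
move=> [L L0 fL]; exists (10 * expR L * (1 + L)).
  by rewrite !mulr_ge0 ?expR_ge0// addr_ge0.
move=> t x y x1 y1; have [f1 f2] := fL t _ _ x1 y1.
have [f3 _] := fL t _ _ y1 y1.
have e0 := expR_ge0 L; split.
  apply: (le_trans (l1_cexp_le f1)).
  by have := mulr_ge0 e0 L0; lra.
apply: (le_trans (l1_cexpB_le f1 f3)); have := l1_ge0 (f t x - f t y).
have := normr_ge0 (x - y); move: f2; set n := `|_|; set m := l1 _ => f2.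
by move=> n0 m0; rewrite -!mulrA ler_wpM2l// ler_wpM2l//; nra.
Qed.

Lemma ulip_csin f : ulip f -> ulip (fun t x => csin (f t x)).
Proof.
move=> uf; rewrite /csin; apply: ulipM; first exact: ulip_const.
by apply: ulipD; [|apply: ulipN]; apply: ulip_cexp; [|apply: ulipN];
  apply: ulipM => //; exact: ulip_const.
Qed.

Lemma ulip_ccos f : ulip f -> ulip (fun t x => ccos (f t x)).
Proof.
move=> uf; rewrite /ccos; apply: ulipM; last exact: ulip_const.
by apply: ulipD; apply: ulip_cexp; [|apply: ulipN];
  apply: ulipM => //; exact: ulip_const.
Qed.
End UniformLipschitz.

(** * The transcendental equation *)

Section ComplexTriples.
Variable R : realType.
Notation M := ('M[R]_(3, 2)).

(** A triple of complex numbers is stored as a real matrix with one row per number: with the sup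
    norm, this is a complete normed module over the reals. *)
Definition zc (i : 'I_3) (X : M) : R[i] := Complex (X i 0) (X i 1).

Definition of_triple (a b c : R[i]) : M :=
  \matrix_(i, j) if j == 0 then complex.Re ([:: a; b; c]`_i)
                 else complex.Im ([:: a; b; c]`_i).

Lemma zc_of_triple i a b c : zc i (of_triple a b c) = [:: a; b; c]`_i.
Proof. by rewrite /zc !mxE /=; case: _`_i. Qed.

Lemma zcD i X Y : zc i (X + Y) = zc i X + zc i Y.
Proof. by rewrite /zc !mxE. Qed.

Lemma zcB i X Y : zc i (X - Y) = zc i X - zc i Y.
Proof. by rewrite /zc !mxE. Qed.

Lemma zcZ i (d : R) X : zc i (d *: X) = d%:C%C * zc i X.
Proof. by rewrite /zc !mxE; apply/eqP; rewrite eq_complex /= !mul0r subr0 addr0 !eqxx. Qed.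

Lemma of_tripleB a b c a' b' c' :
  of_triple a b c - of_triple a' b' c' = of_triple (a - a') (b - b') (c - c').
Proof.
apply/matrixP => -[[|[|[|//]]] ?] j; rewrite !mxE /=; case: (j == 0);
  by [case: a a' => ? ? [] | case: b b' => ? ? [] | case: c c' => ? ? []].
Qed.

Lemma norm_of_triple a b c (r : R) : l1 a <= r -> l1 b <= r -> l1 c <= r ->
  `|of_triple a b c| <= r.
Proof.
move=> ar br cr; have r0 : 0 <= r by exact: le_trans (l1_ge0 a) ar.
have h z : l1 z <= r -> `|complex.Re z| <= r /\ `|complex.Im z| <= r.
  by rewrite /l1 => h; have := normr_ge0 (complex.Re z);
    have := normr_ge0 (complex.Im z); split; lra.
have [ar1 ar2] := h _ ar; have [br1 br2] := h _ br; have [cr1 cr2] := h _ cr.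
rewrite [`|_|]mx_normrE; apply/bigmax_leP; split => // -[i j] _ /=; rewrite mxE.
by case: (j == 0); case: i => -[|[|[|//]]] /=.
Qed.

Lemma l1_zc i X : l1 (zc i X) <= 2 * `|X|.
Proof.
have h j : `|X i j| <= `|X|.
  rewrite [leRHS]mx_normrE.
  by apply: (le_trans _ (le_bigmax _ _ (i, j))).
by have := h 0; have := h 1; rewrite /l1 /=; lra.
Qed.

Lemma ulip_zc (T : Type) i : ulip (fun (_ : T) (X : M) => zc i X).
Proof.
exists 2 => // t X Y X1 Y1; split; last by rewrite -zcB l1_zc.
by apply: (le_trans (l1_zc _ _)); lra.
Qed.

Lemma ulip_of_triple (T : Type) (f g h : T -> M -> R[i]) :
  ulip f -> ulip g -> ulip h -> exists2 L : R, 0 <= L &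
  forall t X Y, `|X| <= 1 -> `|Y| <= 1 ->
    `|of_triple (f t X) (g t X) (h t X)| <= L /\
    `|of_triple (f t X) (g t X) (h t X) - of_triple (f t Y) (g t Y) (h t Y)|
      <= L * `|X - Y|.
Proof.
move=> [L1 L10 fL] [L2 L20 gL] [L3 L30 hL]; exists (L1 + L2 + L3).
  by rewrite !addr_ge0.
move=> t X Y X1 Y1; have [f1 f2] := fL t _ _ X1 Y1.
have [g1 g2] := gL t _ _ X1 Y1; have [h1 h2] := hL t _ _ X1 Y1.
have n0 := normr_ge0 (X - Y).
rewrite of_tripleB; split; apply: norm_of_triple; try lra.
- by apply: (le_trans f2); rewrite ler_wpM2r//; lra.
- by apply: (le_trans g2); rewrite ler_wpM2r//; lra.
- by apply: (le_trans h2); rewrite ler_wpM2r//; lra.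
Qed.
End ComplexTriples.

(** * Existence of a weakly damped eigenvalue *)

Section DampedEigenvalue.
Variable R : realType.

Lemma cexp_i_pihalf (a : R[i]) :
  cexp ('i%C * ((pi / 2 : R)%:C%C - a)) = 'i%C * cexp (- ('i%C * a)).
Proof.
have -> : 'i%C * ((pi / 2 : R)%:C%C - a) = 'i%C * (pi / 2 : R)%:C%C + - ('i%C * a) by ring.
rewrite cexpD; congr (_ * _); apply/eqP; rewrite eq_complex /=.
by rewrite !(mul0r, mul1r, mulr0, subr0, addr0, add0r, oppr0) expR0 cos_pihalf
  sin_pihalf !mulr0 !mul1r !eqxx.
Qed.

Lemma cexp_Ni_pihalf (a : R[i]) :
  cexp (- ('i%C * ((pi / 2 : R)%:C%C - a))) = - 'i%C * cexp ('i%C * a).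
Proof.
have ii : 'i%C * 'i%C = -1 :> R[i] by rewrite -expr2 sqr_i.
have e := cexp_i_pihalf a.
apply: (mulfI (cexp_neq0 ('i%C * ((pi / 2 : R)%:C%C - a)))).
rewrite cexpNK e -(cexpNK ('i%C * a)).
transitivity (- ('i%C * 'i%C) * (cexp ('i%C * a) * cexp (- ('i%C * a)))); first by rewrite ii; ring.
ring.
Qed.

(* [tau = 1] is the Neumann condition at x = 1/2, and [tau = -1] the Dirichlet
   one; the third equation expresses that X is C^1 at x = sigma. *)
Lemma damped_eigenvalue (sigma ell B : R) (tau : R[i]) :
  0 < sigma -> 0 < ell -> 0 < B ->
  exists K : R, forall nu : R, K <= nu -> exists z k kap : R[i],
  let c := cexp ('i%C * k * sigma%:C%C) in
  let c' := cexp (- ('i%C * k * sigma%:C%C)) in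
  let e := cexp (ell%:C%C * kap) in
  let e' := cexp (- (ell%:C%C * kap)) in
  [/\ z ^+ 2 = - ((nu ^+ 2)%:C%C + k ^+ 2),
      kap ^+ 2 = B%:C%C * z - k ^+ 2,
      kap * (c + c') * (e - tau * e') = - ('i%C * k) * (c - c') * (e + tau * e'),
      e + tau * e' != 0 &
      [/\ z != 0, `|complex.Re z| * (nu * Num.sqrt nu) <= K & l1 z <= 3 * nu]].
Proof.
move=> sigma0 ell0 B0.
have ii : 'i%C * 'i%C = -1 :> R[i] by rewrite -expr2 sqr_i.
pose T := {x : R | 1 <= x}.
pose sq (t : T) := Num.sqrt (sval t); pose d (t : T) := (sq t)^-1.
pose sB := Num.sqrt (B / 2).
have sB0 : 0 < sB by rewrite sqrtr_gt0 divr_gt0.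
have sB2 : sB * sB = B / 2 by rewrite -expr2 sqr_sqrtr// divr_ge0// ltW.
have sq1 t : 1 <= sq t by rewrite -[leLHS]sqrtr1 ler_wsqrtr// (svalP t).
have sq0 t : 0 < sq t by exact: lt_le_trans (sq1 t).
have sq2 t : sq t * sq t = sval t.
  by rewrite -expr2 sqr_sqrtr// (le_trans ler01)// (svalP t).
have d0 t : 0 < d t by rewrite invr_gt0.
have d1 t : d t <= 1 by rewrite invf_le1.
have dsq t : d t * sq t = 1 by rewrite mulVf ?gt_eqF.
(* [d t * c1] is the inverse of [k0 t], and [c2 t] is nu^(1/2) exp(-2 ell k0), which stays bounded
   because Re k0 is a positive multiple of nu^(1/2). *)
pose c1 : R[i] := (1 - 'i%C) / 2 * (sB^-1)%:C%C.
pose k0 (t : T) : R[i] := (1 + 'i%C) * (sB * sq t)%:C%C.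
pose c2 (t : T) : R[i] := (sq t)%:C%C * cexp (- (2 * ell)%:C%C * k0 t).
(* The unknowns are th, s and m, where k sigma = pi / 2 - th, z = i (nu + s) and
   kap = k0 + m with k0 ^ 2 = i B nu. *)
pose i2 : 'I_3 := Ordinal (isT : (2 < 3)%N).
pose th (X : 'M[R]_(3, 2)) := zc 0 X.
pose s (X : 'M[R]_(3, 2)) := zc 1 X.
pose m (X : 'M[R]_(3, 2)) := zc i2 X.
pose kk (X : 'M[R]_(3, 2)) := ((pi / 2)%:C%C - th X) * (sigma^-1)%:C%C.
pose F (t : T) (X : 'M[R]_(3, 2)) := c2 t * cexp (- (2 * ell)%:C%C * m X).
pose E (t : T) (X : 'M[R]_(3, 2)) := (d t)%:C%C * F t X.
(* Here [E] = exp(-2 ell kap) = e' / e and [F] = nu^(1/2) [E]. Divided by [k0], the matching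
   condition reads csin th = d H1. The relation 2 nu s = k^2 - s^2, which is the equation for z^2,
   reads s = d H2, and 2 k0 m = i B s - k^2 - m^2, which is the one for kap^2, reads m = d H3. *)
pose H1 (t : T) (X : 'M[R]_(3, 2)) :=
  c1 * (kk X * ccos (th X) * (1 + tau * E t X) +
        - (m X * (1 + - (tau * E t X)) * csin (th X))) +
  tau * (F t X * csin (th X)).
pose H2 (t : T) (X : 'M[R]_(3, 2)) :=
  (d t / 2)%:C%C * (kk X * kk X + - (s X * s X)).
pose H3 (t : T) (X : 'M[R]_(3, 2)) :=
  c1 / 2 * ('i%C * B%:C%C * s X + - (kk X * kk X) + - (m X * m X)).
have uth : ulip (fun (_ : T) => th) by exact: ulip_zc.
have us : ulip (fun (_ : T) => s) by exact: ulip_zc.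
have um : ulip (fun (_ : T) => m) by exact: ulip_zc.
have uk : ulip (fun (_ : T) => kk).
  apply: ulipM; last exact: ulip_const.
  by apply: ulipD; [exact: ulip_const|exact: ulipN].
have uc2 : ulip (fun (t : T) (_ : 'M[R]_(3, 2)) => c2 t).
  apply: (@ulip_cst _ _ _ _ (2 * (2 * ell * sB)^-1)) => t.
  apply: (le_trans (l1M _ _)); rewrite l1_real (ger0_norm (ltW (sq0 t))).
  set y := 2 * ell * sB * sq t.
  have y0 : 0 < y by rewrite !mulr_gt0.
  have : l1 (cexp (- (2 * ell)%:C%C * k0 t)) <= 2 * expR (- y).
    have -> : - (2 * ell)%:C%C * k0 t = Complex (- y) (- y).
      by apply/eqP; rewrite eq_complex /= /y; apply/andP; split; apply/eqP; ring.
    rewrite /l1 /= !normrM (ger0_norm (expR_ge0 _)).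
    have := expR_ge0 (- y).
    have : `|cos (- y)| <= 1 by rewrite ler_norml cos_geN1 cos_le1.
    have : `|sin (- y)| <= 1 by rewrite ler_norml sin_geN1 sin_le1.
    nra.
  have : expR (- y) <= y^-1.
    rewrite expRN lef_pV2 ?posrE ?expR_gt0//.
    by apply: (le_trans _ (expR_ge1Dx y)); rewrite lerDr.
  move=> h1 h2; apply: (@le_trans _ _ (sq t * (2 * y^-1))).
    by rewrite ler_wpM2l// ?(ltW (sq0 t))//; lra.
  rewrite le_eqVlt; apply/orP; left; apply/eqP; rewrite /y.
  by field; rewrite !gt_eqF.
have uF : ulip F.
  apply: ulipM => //; apply: ulip_cexp; apply: ulipM => //; exact: ulip_const.
have uE : ulip E.
  apply: ulipM => //; apply: (@ulip_cst _ _ _ _ 1) => t.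
  by rewrite l1_real (ger0_norm (ltW (d0 t))).
have uH1 : ulip H1.
  apply: ulipD; (apply: ulipM; first exact: ulip_const).
    apply: ulipD.
      apply: ulipM.
        by apply: ulipM => //; exact: ulip_ccos.
      by apply: ulipD; [|apply: ulipM => //]; exact: ulip_const.
    apply: ulipN; apply: ulipM; last exact: ulip_csin.
    apply: ulipM => //; apply: ulipD; first exact: ulip_const.
    by apply: ulipN; apply: ulipM => //; exact: ulip_const.
  by apply: ulipM => //; exact: ulip_csin.
have uH2 : ulip H2.
  apply: ulipM.
    apply: (@ulip_cst _ _ _ _ 1) => t; rewrite l1_real ger0_norm; have := d0 t; have := d1 t; lra.
  by apply: ulipD; [|apply: ulipN]; exact: ulipM.
have uH3 : ulip H3.
  apply: ulipM; first exact: ulip_const.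
  apply: ulipD; [|by apply: ulipN; exact: ulipM].
  apply: ulipD; [|by apply: ulipN; exact: ulipM].
  by apply: ulipM => //; exact: ulip_const.
have [L L0 HL] := ulip_of_triple uH1 uH2 uH3.
have [LF LF0 FL] := uF.
(* Chosen so that |Re z| <= [Kr] d^3: the estimate of Im s below gives d^2 (6 / sigma^2 + 2) |X|,
   and the fixed point satisfies |X| <= 2 d L. *)
pose Kr := (6 / sigma ^+ 2 + 2) * (2 * L).
have Kr0 : 0 <= Kr by rewrite !mulr_ge0// addr_ge0// divr_ge0// sqr_ge0.
(* Kept abstract: computing with a unary numeral of this size is slow. *)
have [q q0 qE] : exists2 q : R, 0 < q & q = 2240 by exists 2240; lra.
(* One number serves as threshold and as bound. The 1 gives nu >= 1; the first square gives d L <= 1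
   / 2240, a quarter of the radius 1 / 560 of the ball; the second gives |tau E| < 1, hence e + tau
   e' nonzero; [Kr] bounds the damping. *)
exists (1 + (q * L) ^+ 2 + (l1 tau * LF) ^+ 2 + Kr) => nu nuK.
have a0 := sqr_ge0 (q * L); have b0 := sqr_ge0 (l1 tau * LF).
have qL0 : 0 <= q * L by rewrite mulr_ge0// ltW.
have tF0 : 0 <= l1 tau * LF by rewrite mulr_ge0// l1_ge0.
move: Kr0 a0 b0 nuK; set A := (q * L) ^+ 2; set A' := _ ^+ 2.
move=> Kr0 a0 b0 nuK.
have [nu1 nuA nuA'] : [/\ 1 <= nu, A <= nu & A' < nu].
  by clear -Kr0 a0 b0 nuK; split; lra.
have nuKr : Kr <= 1 + A + A' + Kr by clear -a0 b0; lra.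
pose t : T := exist _ nu nu1.
have sqL : q * L <= sq t.
  by rewrite -(ger0_norm qL0) -sqrtr_sqr ler_wsqrtr.
have sqF : l1 tau * LF < sq t.
  rewrite -(ger0_norm tF0) -sqrtr_sqr ltr_sqrt// (lt_le_trans ltr01)//.
have dL : d t * L <= 1 / 2240.
  have : d t * (q * L) <= 1 by rewrite -(dsq t) ler_wpM2l// ltW.
  by clear -qE; rewrite qE; lra.
have dF : l1 tau * (d t * LF) < 1.
  have -> : l1 tau * (d t * LF) = d t * (l1 tau * LF) by ring.
  by rewrite -(dsq t) ltr_pM2l.
(* The equation csin th = d H1 is solved for th in the form th = (th - csin th) + d H1, whose first
   term has a small Lipschitz constant near 0. *)
pose G0 (X : 'M[R]_(3, 2)) := of_triple (th X - csin (th X)) 0 0.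
(* On this ball [a - csin a] has Lipschitz constant 35 / 280, and [zc] has 2. *)
have G0c (X Y : 'M[R]_(3, 2)) : `|X| <= 1 / 560 -> `|Y| <= 1 / 560 ->
    `|G0 X - G0 Y| <= 4^-1 * `|X - Y|.
  move=> X1 Y1; rewrite of_tripleB.
  have n0 := normr_ge0 (X - Y).
  have z0 : l1 (0 - 0 : R[i]) <= 4^-1 * `|X - Y|.
    by rewrite subrr /l1 normr0 addr0 mulr_ge0// invr_ge0.
  apply: norm_of_triple => //.
  have hX := l1_zc 0 X; have hY := l1_zc 0 Y; have hXY := l1_zc 0 (X - Y).
  rewrite zcB in hXY.
  have r4 : 1 / 280 <= 4^-1 :> R by clear; lra.
  apply: (le_trans (@l1_csinB_le _ (th X) (th Y) _ r4 _ _)).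
  - by apply: (le_trans hX); clear -X1; lra.
  - by apply: (le_trans hY); clear -Y1; lra.
  - by move: hXY; rewrite -/(th X) -/(th Y); clear; lra.
have G00 : G0 0 = 0.
  have th0 : th 0 = 0 by rewrite /th /zc !mxE.
  rewrite /G0 th0 /csin mulr0 oppr0 subrr mulr0 subr0.
  by apply/matrixP => -[[|[|[|//]]] ?] j; rewrite !mxE /=; case: (j == 0).
pose H X := of_triple (H1 t X) (H2 t X) (H3 t X).
have r1 (X : 'M[R]_(3, 2)) : `|X| <= 1 / 560 -> `|X| <= 1 by clear=> h; lra.
have [|||||X XE Xn] := @perturbed_contraction_fixpoint R 'M[R]_(3, 2) G0 H (1 / 560) (d t) L
  _ (ltW (d0 t)) L0 _ _ G00 G0c.
- by clear; lra.
- by clear -dL; lra.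
- by clear -dL; lra.
- by move=> X /r1 X1; have [] := HL t X X X1 X1.
- by move=> X Y /r1 X1 /r1 Y1; have [] := HL t X Y X1 Y1.
have Et : E t X = cexp (- (2 * ell)%:C%C * (k0 t + m X)).
  have dsqC : (d t)%:C%C * (sq t)%:C%C = 1 :> R[i] by rewrite -rmorphM dsq.
  rewrite /E /F /c2 mulrDr cexpD; move: (cexp _) (cexp _) => y x.
  by rewrite -(mulrA _ x y) [LHS]mulrA dsqC mul1r.
have hsin : csin (th X) = (d t)%:C%C * H1 t X.
  have : th X = th X - csin (th X) + (d t)%:C%C * H1 t X.
    by rewrite {1}/th {1}XE zcD zcZ !zc_of_triple.
  by move: (th X) (csin _) (_ * _) => a b w /(congr1 (fun x => x - a + b)) h;
    transitivity (a - a + b); [ring|rewrite h; ring].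
have hs : s X = (d t)%:C%C * H2 t X.
  by rewrite {1}/s {1}XE zcD zcZ !zc_of_triple /= add0r.
have hm : m X = (d t)%:C%C * H3 t X.
  by rewrite {1}/m {1}XE zcD zcZ !zc_of_triple /= add0r.
have hk : (d t)%:C%C * c1 * k0 t = 1.
  have dsqC : (d t)%:C%C * (sq t)%:C%C = 1 :> R[i] by rewrite -rmorphM dsq.
  have sBC : (sB^-1)%:C%C * sB%:C%C = 1 :> R[i] by rewrite -rmorphM mulVf ?gt_eqF.
  rewrite /c1 /k0 rmorphM /=.
  transitivity (((d t)%:C%C * (sq t)%:C%C) * ((sB^-1)%:C%C * sB%:C%C) *
     ((1 - 'i%C * 'i%C) / 2) : R[i]).
    by move: (d t)%:C%C (sq t)%:C%C (sB^-1)%:C%C sB%:C%C => x1 x2 x3 x4; field.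
  by rewrite dsqC sBC ii; field.
have hk0 : k0 t ^+ 2 = 'i%C * (B * nu)%:C%C.
  rewrite /k0; transitivity ((1 + 2 * 'i%C + 'i%C * 'i%C) * ((sB * sB) * (sq t * sq t))%:C%C : R[i]).
    by rewrite !rmorphM /=; ring.
  by rewrite ii sB2 sq2 /= !rmorphM /= fmorphV rmorph_nat; field.
have tE : l1 (tau * E t X) < 1.
  apply: le_lt_trans dF; apply: (le_trans (l1M _ _)); rewrite ler_wpM2l ?l1_ge0//.
  apply: (le_trans (l1M _ _)); rewrite l1_real (ger0_norm (ltW (d0 t))) ler_wpM2l ?(ltW (d0 t))//.
  have X1 : `|X| <= 1 by clear -Xn dL; lra.
  by have [] := FL t X X X1 X1.
have X1 : `|X| <= 2^-1 by clear -Xn dL; lra.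
exists ('i%C * (nu%:C%C + s X)), (kk X), (k0 t + m X) => c c' e e'.
(* Since k sigma = pi / 2 - th, the quarter-period shift turns c + c' into 2 csin th and c - c' into
   2 i ccos th. *)
have cE : c = 'i%C * cexp (- ('i%C * th X)).
  rewrite /c -cexp_i_pihalf; congr cexp; rewrite /kk.
  by rewrite fmorphV; field; rewrite fmorph_eq0 gt_eqF.
have c'E : c' = - 'i%C * cexp ('i%C * th X).
  rewrite /c' -cexp_Ni_pihalf; congr cexp; rewrite /kk.
  by rewrite fmorphV; field; rewrite fmorph_eq0 gt_eqF.
have e'E : e' = e * E t X.
  by rewrite Et /e' /e -cexpD; congr cexp; rewrite rmorphM /= rmorph_nat; ring.
have cc' : c + c' = 2 * csin (th X) by rewrite cE c'E /csin; field.
have ccB : c - c' = 2 * 'i%C * ccos (th X) by rewrite cE c'E /ccos; field.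
have s2 : 2 * nu%:C%C * s X = kk X * kk X - s X * s X.
  have d2 : 2 * nu%:C%C * ((d t)%:C%C * (d t / 2)%:C%C) = 1 :> R[i].
    have -> : 2 = 2%:C%C :> R[i] by rewrite rmorph_nat.
    rewrite -!rmorphM /=.
    have -> : 2 * nu * (d t * (d t / 2)) = (d t * sq t) * (d t * sq t).
      have -> : nu = sq t * sq t by rewrite sq2.
      by move: (d t) (sq t) => x y; field.
    by rewrite dsq mulr1.
  rewrite {1}hs /H2; move: d2.
  move: (2 * _) (d t)%:C%C (_ / 2)%:C%C (_ * _ + _) => x1 x2 x3 x4 e1.
  by transitivity (x1 * (x2 * x3) * x4); [ring|rewrite e1 mul1r].
split.
- transitivity ('i%C * 'i%C * ((nu ^+ 2)%:C%C + (2 * nu%:C%C * s X) + s X ^+ 2) : R[i]).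
    by rewrite rmorphXn /=; ring.
  by rewrite ii s2; ring.
- have m2 : 2 * k0 t * m X = 'i%C * B%:C%C * s X - kk X * kk X - m X * m X.
    have gen (x1 x2 x3 x4 : R[i]) : x2 * x3 * x4 = 1 ->
        2 * x4 * (x2 * (x3 / 2 * x1)) = x1.
      by move=> e1; transitivity (x2 * x3 * x4 * x1); [field|rewrite e1 mul1r].
    by rewrite {1}hm /H3; exact: gen hk.
  transitivity (k0 t ^+ 2 + 2 * k0 t * m X + m X * m X); first by ring.
  by rewrite hk0 m2 rmorphM /=; ring.
- have hs3 : k0 t * csin (th X) =
      kk X * ccos (th X) * (1 + tau * E t X) -
      m X * (1 - tau * E t X) * csin (th X) + k0 t * tau * E t X * csin (th X).
    have gen (x1 x2 x3 x4 f sn : R[i]) : x2 * x3 * x4 = 1 ->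
        x4 * (x2 * (x3 * x1 + tau * (f * sn))) = x1 + x4 * tau * (x2 * f) * sn.
      move=> e1; transitivity (x2 * x3 * x4 * x1 + x4 * tau * (x2 * f) * sn).
        by ring.
      by rewrite e1 mul1r.
    by rewrite {1}hsin; exact: gen hk.
  rewrite cc' ccB e'E.
  have -> : (k0 t + m X) * (2 * csin (th X)) * (e - tau * (e * E t X)) =
    2 * e * (k0 t * csin (th X) - k0 t * tau * E t X * csin (th X) +
             m X * (1 - tau * E t X) * csin (th X)) by ring.
  rewrite hs3.
  transitivity (- ('i%C * 'i%C) * 2 * e * (kk X * ccos (th X) * (1 + tau * E t X)));
    last by ring.
  by rewrite ii; ring.
- rewrite e'E; apply/eqP => h.
  have : e * (1 + tau * E t X) = 0 by rewrite -h; ring.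
  move/eqP; rewrite mulf_eq0 (negbTE (cexp_neq0 _)) /= addr_eq0 => /eqP h1.
  move: tE; rewrite -l1N -h1 {1}/l1 /= normr0 normr1 addr0.
  by rewrite ltxx.
have := l1_zc 1 X; have := l1_zc 0 X.
rewrite -/(s X) -/(th X) /l1.
set t1 := complex.Re (th X); set t2 := complex.Im (th X).
set s1 := complex.Re (s X); set s2' := complex.Im (s X) => ht hs'.
have t10 := normr_ge0 t1; have t20 := normr_ge0 t2.
have s10 := normr_ge0 s1; have s20 := normr_ge0 s2'.
have zRe : complex.Re ('i%C * (nu%:C%C + s X)) = - s2'.
  by rewrite /s2'; case: (s X) => x y /=; ring.
have zIm : complex.Im ('i%C * (nu%:C%C + s X)) = nu + s1.
  by rewrite /s1; case: (s X) => x y /=; ring.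
have s1lo : - `|s1| <= s1 by rewrite lerNl -normrN ler_norm.
split.
- apply/eqP => /(congr1 (@complex.Im R)); rewrite zIm /=.
  have : `|X| < 2^-1 by clear -Xn dL; lra.
  by clear -nu1 hs' s1lo s20; lra.
- rewrite zRe normrN.
  (* The crux of the rate: Re z = - Im s, and s carries the factor d^2 / 2. The main part (pi / (2
     sigma))^2 of k^2 is real, so that each remaining term contains Im th or Im s, of size d; in all
     Im s has size d^3. *)
  have Ims : s2' = d t * (d t / 2) *
      (- (2 * (pi / 2 - t1) * t2 * (sigma^-1) ^+ 2) - 2 * s1 * s2').
    rewrite {1}/s2' hs /H2 /kk /t1 /t2 /s1 /s2'.
    by move: (th X) (s X) => [x1 x2] [y1 y2] /=; ring.
  have pi2 : `|pi / 2 - t1| <= 3.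
    apply: (le_trans (ler_normB _ _)); rewrite ger0_norm ?divr_ge0 ?pi_ge0//.
    by have := pihalf_lt2 R; clear -X1 ht t20; lra.
  have b1 : `|2 * (pi / 2 - t1) * t2 * (sigma^-1) ^+ 2| <= 12 * `|X| * (sigma^-1) ^+ 2.
    rewrite normrM (ger0_norm (sqr_ge0 _)) ler_wpM2r ?sqr_ge0//.
    rewrite !normrM (ger0_norm (_ : 0 <= 2))//.
    have t2X : `|t2| <= 2 * `|X| by clear -ht t10; lra.
    have := ler_pM (normr_ge0 _) t20 pi2 t2X; clear; lra.
  have b2 : `|2 * s1 * s2'| <= 4 * `|X|.
    rewrite !normrM (ger0_norm (_ : 0 <= 2))//.
    have s2X : `|s2'| <= 2 * `|X| by clear -hs' s10; lra.
    have s1X : `|s1| <= 1 by clear -hs' s20 X1; lra.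
    have := ler_pM s10 s20 s1X s2X; clear; lra.
  have dd0 : 0 <= d t * (d t / 2) by rewrite !mulr_ge0// ltW.
  have b3 : `|s2'| <= d t * (d t / 2) * (12 * `|X| * (sigma^-1) ^+ 2 + 4 * `|X|).
    rewrite {1}Ims normrM (ger0_norm dd0) ler_wpM2l//.
    by apply: (le_trans (ler_normB _ _)); rewrite normrN lerD.
  have b4 : `|s2'| <= d t ^+ 3 * Kr.
    apply: (le_trans b3); rewrite /Kr.
    have -> : d t * (d t / 2) * (12 * `|X| * (sigma^-1) ^+ 2 + 4 * `|X|) =
      d t ^+ 2 * (6 / sigma ^+ 2 + 2) * `|X|.
      by rewrite -exprVn; move: (d t) `|X| (sigma^-1) => x y w; field.
    have -> : d t ^+ 3 * ((6 / sigma ^+ 2 + 2) * (2 * L)) =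
      d t ^+ 2 * (6 / sigma ^+ 2 + 2) * (2 * (d t * L)) by ring.
    rewrite ler_wpM2l// mulr_ge0 ?sqr_ge0// addr_ge0// divr_ge0 ?sqr_ge0//.
  apply: le_trans nuKr.
  have -> : Kr = d t ^+ 3 * Kr * (nu * Num.sqrt nu).
    have -> : nu * Num.sqrt nu = sq t ^+ 3 by rewrite !exprS expr0 mulr1 mulrA sq2.
    by rewrite mulrAC -exprMn dsq expr1n mul1r.
  by rewrite ler_wpM2r// mulr_ge0 ?sqrtr_ge0// (le_trans ler01).
rewrite zRe zIm normrN.
have := ler_normD nu s1; rewrite (ger0_norm (le_trans ler01 nu1)).
by clear -hs' X1 nu1; lra.
Qed.
End DampedEigenvalue.

(** * Calculus on an interval and on the cell *)

Section Glue.
Variable R : realType.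
Implicit Types (f g : R -> R) (c x : R).

Definition glue (T : Type) (c : R) (f g : R -> T) (x : R) : T := if x < c then f x else g x.

Lemma is_derive_continuous f (f' : R -> R) :
  (forall x, is_derive x 1 f (f' x)) -> continuous f.
Proof.
move=> df x; apply/differentiable_continuous/derivable1_diffP.
by have [] := df x.
Qed.

(** At [c] the difference quotients of both pieces tend to the common derivative, and each increment
    uses one of them; elsewhere the glued function coincides locally with one piece. *)
Lemma is_derive_glue f g (f' g' : R -> R) c :
  (forall x, is_derive x 1 f (f' x)) -> (forall x, is_derive x 1 g (g' x)) ->
  f c = g c -> f' c = g' c ->
  forall x, is_derive x 1 (glue c f g) (glue c f' g' x).
Proof.
move=> df dg fg fg' x; rewrite /glue; have [xc|cx|->] := ltgtP x c.
- apply: near_eq_is_derive (df x).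
  by near do rewrite ifT//; exact: lt_nbhsl.
- apply: near_eq_is_derive (dg x).
  near=> y; rewrite ifF//; apply/negbTE; rewrite -leNgt ltW//.
  by near: y; exact: lt_nbhsr.
- have quotf : (fun h => h^-1 *: (f (h *: 1 + c) - f c)) @ 0^' --> g' c.
    by rewrite -fg'; have [fc <-] := df c; exact: fc.
  have quotg : (fun h => h^-1 *: (g (h *: 1 + c) - g c)) @ 0^' --> g' c.
    by have [gc <-] := dg c; exact: gc.
  have quot : (fun h => h^-1 *: (glue c f g (h *: 1 + c) - glue c f g c)) @ 0^' --> g' c.
    apply/cvgrPdist_le => e e0.
    have /cvgrPdist_le/(_ e e0) nf := quotf; have /cvgrPdist_le/(_ e e0) ng := quotg.
    near=> h; rewrite /glue ltxx; case: ifPn => _.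
      by rewrite -fg; near: h.
    by near: h.
  by apply: DeriveDef; [apply/cvg_ex; exists (g' c)|exact: cvg_lim].
Unshelve. all: by end_near. Qed.

Lemma continuous_glue f g c : continuous f -> continuous g -> f c = g c ->
  continuous (glue c f g).
Proof.
move=> cf cg fg x; apply/cvgrPdist_le => e e0.
have /cvgrPdist_le/(_ e e0) nf := cf x; have /cvgrPdist_le/(_ e e0) ng := cg x.
rewrite /glue; have [xc|cx|xc] := ltgtP x c.
- near=> y; rewrite ifT; first by near: y.
  by near: y; exact: lt_nbhsl.
- near=> y; rewrite ifF; first by near: y.
  by apply/negbTE; rewrite -leNgt ltW//; near: y; exact: lt_nbhsr.
- by rewrite xc in nf ng *; near=> y; case: ifPn => _; [rewrite -fg|]; near: y.
Unshelve. all: by end_near. Qed.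
End Glue.

(** * Bounded measurable functions *)

Section MeasurableBounded.
Context d (T : measurableType d) (R : realType).
Implicit Types (D : set T) (f g : T -> R).

(** Measurability is global and boundedness only on [D]: the class is closed under sums and
    products, contains the continuous functions when [D] is compact, and gives integrability on a
    set of finite measure. *)
Definition mbd D f := measurable_fun setT f /\ exists M, forall x, D x -> `|f x| <= M.

Lemma mbdD D f g : mbd D f -> mbd D g -> mbd D (fun x => f x + g x).
Proof.
move=> [mf [M fM]] [mg [N gN]]; split; first exact: measurable_funD.
exists (M + N) => x Dx; apply: (le_trans (ler_normD _ _)).
by rewrite lerD ?fM ?gN.
Qed.

Lemma mbdM D f g : mbd D f -> mbd D g -> mbd D (fun x => f x * g x).
Proof.
move=> [mf [M fM]] [mg [N gN]]; split; first exact: measurable_funM.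
by exists (M * N) => x Dx; rewrite normrM ler_pM ?fM ?gN.
Qed.

Lemma mbd_cst D (c : R) : mbd D (fun=> c).
Proof. by split => //; exists `|c|. Qed.

Lemma mbdN D f : mbd D f -> mbd D (fun x => - f x).
Proof.
move=> [mf [M fM]]; split; first exact: measurableT_comp mf.
by exists M => x Dx; rewrite normrN fM.
Qed.

Lemma mbd_integrable (mu : {measure set T -> \bar R}) D f : measurable D -> (mu D < +oo)%E ->
  mbd D f -> mu.-integrable D (EFin \o f).
Proof.
move=> mD muD [mf [M fM]]; apply: measurable_bounded_integrable => //.
  exact: measurable_funS mf.
exists M; split; first exact: num_real.
by move=> N MN x Dx; exact: (le_trans (fM _ Dx) (ltW MN)).
Qed.
End MeasurableBounded.

(** * Weak derivatives on an interval *)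

Section WeakDerivative.
Variable R : realType.
Notation mu := (@lebesgue_measure R).
Implicit Types (f g phi : R -> R) (a b c x : R).

Lemma mbd_continuous f a b : continuous f -> mbd `[a, b]%classic f.
Proof.
move=> cf; split; first exact: continuous_measurable_fun.
have : bounded_set (f @` `[a, b]).
  apply: compact_bounded; apply: continuous_compact (@segment_compact _ a b).
  exact: continuous_subspaceT.
move=> [M [_ fM]]; exists (M + 1) => x xab.
by apply: (fM (M + 1)); [rewrite ltrDl|exists x].
Qed.

(* Absolute continuity, in the form of integration by parts. *)
Definition weak_derive a b f f' :=
  [/\ mbd `[a, b]%classic f, mbd `[a, b]%classic f' &
   forall phi phi' : R -> R, continuous phi' ->
     (forall x, is_derive x 1 phi (phi' x)) ->
     \int[mu]_(x in `[a, b]) (f x * phi' x + f' x * phi x) =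
       f b * phi b - f a * phi a].

Lemma lebesgue_measure_cc_lty a b : (mu `[a, b]%classic < +oo)%E.
Proof. by rewrite lebesgue_measure_itv /=; case: ifP => _; rewrite ltey. Qed.

Lemma mbd_integrable_cc a b f : mbd `[a, b]%classic f ->
  mu.-integrable `[a, b] (EFin \o f).
Proof.
apply: (@mbd_integrable _ _ _ mu `[a, b]%classic f (measurable_itv _)).
exact: lebesgue_measure_cc_lty.
Qed.

(** The fundamental theorem of calculus for F phi. The derivative is prescribed on the open interval
    only: at a jump of the damping, a single value of f' cannot match the smooth extensions from
    both sides, and endpoints are null sets. *)
Lemma weak_derive_smooth a b f f' (F F' : R -> R) : a < b ->
  measurable_fun setT f -> measurable_fun setT f' ->
  continuous F' -> (forall x, is_derive x 1 F (F' x)) ->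
  (forall x, a <= x <= b -> f x = F x) ->
  (forall x, a < x < b -> f' x = F' x) ->
  weak_derive a b f f'.
Proof.
move=> ab mf mf' cF' dF fF fF'.
have cF := is_derive_continuous dF.
have bf : mbd `[a, b]%classic f.
  have [_ [M FM]] := mbd_continuous a b cF; split => //; exists M => x xab.
  by rewrite fF//; exact: FM.
have bf' : mbd `[a, b]%classic f'.
  have [_ [M FM]] := mbd_continuous a b cF'; split => //.
  exists (M + `|f' a| + `|f' b|) => x; rewrite /= in_itv /= => /andP[ax xb].
  have M0 : 0 <= M by apply: le_trans (normr_ge0 (F' a)) (FM a _); rewrite /= in_itv /= lexx ltW.
  have fa0 := normr_ge0 (f' a); have fb0 := normr_ge0 (f' b).
  move: ax xb; rewrite le_eqVlt => /predU1P[<-|ax]; first by lra.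
  rewrite le_eqVlt => /predU1P[->|xb]; first by lra.
  rewrite fF' ?ax// -addrA (le_trans (FM x _)) ?lerDl ?addr_ge0//.
  by rewrite /= in_itv /= !ltW.
split => // phi phi' cphi' dphi.
have cphi := is_derive_continuous dphi.
have bphi := mbd_continuous a b cphi; have bphi' := mbd_continuous a b cphi'.
have bF := mbd_continuous a b cF; have bF' := mbd_continuous a b cF'.
pose G x := F x * phi' x + F' x * phi x.
have oc_cc : `]a, b] `<=` `[a, b]%classic by exact: subset_itv_oc_cc.
have oo_cc : `]a, b[ `<=` `[a, b]%classic by exact: subset_itv_oo_cc.
have to_oo g : mbd `[a, b]%classic g ->
    \int[mu]_(x in `[a, b]) g x = \int[mu]_(x in `]a, b[) g x.
  move=> bg; have ig := mbd_integrable_cc bg.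
  rewrite -Rintegral_itv_obnd_cbnd; last by apply: integrableS ig.
  by rewrite -Rintegral_itv_bndo_bndc//; apply: integrableS ig.
rewrite to_oo; last by apply: mbdD; exact: mbdM.
have -> : \int[mu]_(x in `]a, b[) (f x * phi' x + f' x * phi x) =
    \int[mu]_(x in `]a, b[) G x.
  apply: eq_Rintegral => x; rewrite inE /= in_itv /= => /andP[ax xb].
  by rewrite /G fF ?fF' ?ax ?xb// !ltW.
rewrite -to_oo; last by apply: mbdD; exact: mbdM.
rewrite !fF ?lexx ?(ltW ab)//.
have dFphi x : is_derive x 1 (fun x => F x * phi x) (G x).
  have := dF x; have := dphi x => h1 h2.
  by apply: is_derive_eq; rewrite /G /GRing.scale /=; ring.
have cFphi := is_derive_continuous dFphi.
rewrite /Rintegral (@continuous_FTC2 _ _ (fun x => F x * phi x))//.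
- apply: continuous_subspaceT => x.
  apply: cvgD; apply: cvgM; [exact: cF|exact: cphi'|exact: cF'|exact: cphi].
- split; first by move=> x _; have [] := dFphi x.
    by apply: cvg_at_right_filter; exact: cFphi.
  by apply: cvg_at_left_filter; exact: cFphi.
- by move=> x _; rewrite derive1E; have [_ ->] := dFphi x.
Qed.

(** The boundary terms at [c] cancel because f has one value there, whereas f' may jump. This is how
    the C^1 matching at |x| = sigma yields a weak second derivative. *)
Lemma weak_derive_cat a b c f f' : a < c -> c < b ->
  weak_derive a c f f' -> weak_derive c b f f' -> weak_derive a b f f'.
Proof.
move=> ac cb [[mf [M1 fM1]] [mf' [N1 fN1]] I1] [[_ [M2 fM2]] [_ [N2 fN2]] I2].
have bnd g (K1 K2 : R) : measurable_fun setT g ->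
    (forall x, `[a, c]%classic x -> `|g x| <= K1) ->
    (forall x, `[c, b]%classic x -> `|g x| <= K2) -> mbd `[a, b]%classic g.
  move=> mg g1 g2; split => //; exists (Num.max K1 K2) => x /=.
  rewrite in_itv /= => /andP[ax xb]; rewrite le_max.
  have [xc|/ltW cx] := leP x c; first by rewrite g1//= in_itv /= ax.
  by rewrite g2 ?orbT//= in_itv /= cx.
have bf := bnd _ _ _ mf fM1 fM2; have bf' := bnd _ _ _ mf' fN1 fN2.
split => // phi phi' cphi' dphi.
have bphi := mbd_continuous a b (is_derive_continuous dphi).
have bphi' := mbd_continuous a b cphi'.
have bG : mbd `[a, b]%classic (fun x => f x * phi' x + f' x * phi x).
  by apply: mbdD; exact: mbdM.
have iG := mbd_integrable_cc bG.
have /eqP := @Rintegral_itvB _ _ (BLeft a) (BRight b) c iG ltac:(by rewrite bnd_simp ltW) ltac:(by rewrite bnd_simp ltW).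
rewrite subr_eq => /eqP ->.
rewrite Rintegral_itv_obnd_cbnd ?I1 ?I2//; first by ring.
apply: integrableS iG => //.
by move=> x /=; rewrite !in_itv /= => /andP[cx ->]; rewrite (le_trans (ltW ac))// ltW.
Qed.
End WeakDerivative.

(** * Integration over the cell *)

Section Cell.
Variable R : realType.
Notation mu := (@lebesgue_measure R).
Notation cell := (cell R).
Notation Ix := `[(- 2^-1 : R), (2^-1 : R)]%classic.
Notation Iy := `[(0 : R), (1 : R)]%classic.

(** An open set is the union of the countably many rectangles with rational endpoints that it
    contains; [F] replaces the other rectangles by the empty set. *)
Lemma open_plane_measurable (U : set (R * R)) : open U -> measurable U.
Proof.
move=> oU.
pose Q := (rat * rat * (rat * rat))%type.
pose rect (q : Q) : set (R * R) :=
  `]ratr q.1.1, ratr q.1.2[%classic `*` `]ratr q.2.1, ratr q.2.2[%classic.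
pose F (q : Q) := if pselect (rect q `<=` U) then rect q else set0.
have -> : U = \bigcup_q F q.
  apply/seteqP; split => [[x y] Uxy|p [q _]]; last first.
    by rewrite /F; case: pselect => // h /h.
  have /nbhs_ballP[e /= e0 eU] : nbhs (x, y) U by exact: open_nbhs_nbhs.
  have e2 : 0 < e / 2 by rewrite divr_gt0.
  have [x1] : exists q : rat, (ratr q : R) \in `]x - e / 2, x[ by apply: rat_in_itvoo; lra.
  rewrite in_itv /= => /andP[x1l x1r].
  have [x2] : exists q : rat, (ratr q : R) \in `]x, x + e / 2[ by apply: rat_in_itvoo; lra.
  rewrite in_itv /= => /andP[x2l x2r].
  have [y1] : exists q : rat, (ratr q : R) \in `]y - e / 2, y[ by apply: rat_in_itvoo; lra.
  rewrite in_itv /= => /andP[y1l y1r].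
  have [y2] : exists q : rat, (ratr q : R) \in `]y, y + e / 2[ by apply: rat_in_itvoo; lra.
  rewrite in_itv /= => /andP[y2l y2r].
  exists ((x1, x2), (y1, y2)) => //; rewrite /F; case: pselect => [h|] /=.
    by split; rewrite /= in_itv /= ?x1r ?y1r.
  apply=> -[a b]; rewrite /rect /= => -[] /=; rewrite !in_itv /= => /andP[a1 a2] /andP[b1 b2].
  by apply: eU; split; rewrite /ball /= ltr_distl; apply/andP; split; lra.
apply: countable_bigcupT_measurable => [|q]; first exact: countableP.
by rewrite /F; case: pselect => [h|h] //=; apply: measurableX; exact: measurable_itv.
Qed.

Lemma continuous_plane_measurable (f : R * R -> R) :
  continuous f -> measurable_fun setT f.
Proof.
move=> /continuousP cf; apply: (measurability _ (RGenOpens.measurableE R)).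
move=> _ [_ [a [b ->] <-]]; rewrite setTI; apply: open_plane_measurable.
exact/cf/interval_open.
Qed.

Lemma measurable_cell : measurable cell.
Proof. by apply: measurableX; exact: measurable_itv. Qed.

Lemma lebesgue_measure_cc (a b : R) : a <= b -> mu `[a, b]%classic = (b - a)%:E.
Proof.
rewrite lebesgue_measure_itv /= lte_fin le_eqVlt => /predU1P[->|->] //.
by rewrite ltxx subrr.
Qed.

Lemma measure_rect (a b c d : R) : a <= b -> c <= d ->
  (leb2 R) (`[a, b]%classic `*` `[c, d]%classic) = ((b - a) * (d - c))%:E.
Proof.
move=> ab cd; rewrite product_measure1E; [|exact: measurable_itv..].
rewrite -[X in X = _]/(mu `[a, b]%classic * mu `[c, d]%classic)%E.
by rewrite !lebesgue_measure_cc.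
Qed.

Lemma measure_cell_lty : ((leb2 R) cell < +oo)%E.
Proof. by rewrite /cell measure_rect ?ltey//; lra. Qed.

Lemma cell_integrable (F : R * R -> R) : mbd cell F ->
  (leb2 R).-integrable cell (EFin \o F).
Proof.
apply: (@mbd_integrable _ _ _ (leb2 R) cell F measurable_cell).
exact: measure_cell_lty.
Qed.

Lemma continuous_mbd_cell (f : R * R -> R) : continuous f -> mbd cell f.
Proof.
move=> cf; split; first exact: continuous_plane_measurable.
have : bounded_set (f @` cell).
  apply: compact_bounded; apply: continuous_compact.
    exact: continuous_subspaceT.
  by apply: compact_setX; exact: segment_compact.
move=> [M [_ fM]]; exists (M + 1) => x xab.
by apply: (fM (M + 1)); [rewrite ltrDl|exists x].
Qed.

(** Fubini for the extension by zero outside the cell: the slices with y outside [0, 1] vanish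
    identically and the others integrate to zero by hypothesis. *)
Lemma cell_integral0_x (F : R * R -> R) : mbd cell F ->
  (forall y, 0 <= y <= 1 -> \int[mu]_(x in `[- 2^-1, 2^-1]) F (x, y) = 0) ->
  \int[leb2 R]_(p in cell) F p = 0.
Proof.
move=> bF F0; have iF := cell_integrable bF.
pose I : set R := `[- 2^-1, 2^-1]%classic.
rewrite /Rintegral integral_mkcond -integral21_prod_meas1; last first.
  by apply/integrable_restrict; [exact: measurable_cell|exact: measurableT|rewrite setTI].
rewrite integral0_eq// => y _.
  rewrite /fubini_G; have [y01|yN] := boolP (0 <= y <= 1).
  - transitivity (\int[mu]_x ((fun s : R => (F (s, y))%:E) \_ I) x)%E.
      apply: eq_integral => x _; rewrite !patchE; congr (if _ then _ else _).
      by apply/asbool_equiv_eq; split => [[]|h]//; split => //=; rewrite in_itv.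
    rewrite -integral_mkcond -[LHS]fineK; first by have := F0 _ y01; rewrite /Rintegral => ->.
    apply: integrable_fin_num => //; first exact: measurable_itv.
    apply: (@mbd_integrable_cc _ _ _ (fun s => F (s, y))).
    have [mF [M FM]] := bF; split.
      apply: (measurableT_comp mF).
      by apply/measurable_fun_pairP; split; [exact: measurable_id|exact: measurable_cst].
    by exists M => x xI; apply: FM; split => //=; rewrite in_itv.
  - apply: integral0_eq => x _; rewrite patchE ifF//; apply/negbTE/negP.
    by rewrite inE => -[_ /=]; rewrite in_itv /= (negbTE yN).
Qed.
Lemma cell_integral0_y (F : R * R -> R) : mbd cell F ->
  (forall x, - 2^-1 <= x <= 2^-1 -> \int[mu]_(y in `[0, 1]) F (x, y) = 0) ->
  \int[leb2 R]_(p in cell) F p = 0.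
Proof.
move=> bF F0; have iF := cell_integrable bF.
pose I : set R := `[0, 1]%classic.
rewrite /Rintegral integral_mkcond -integral12_prod_meas1; last first.
  by apply/integrable_restrict; [exact: measurable_cell|exact: measurableT|rewrite setTI].
rewrite integral0_eq// => x _.
  rewrite /fubini_F; have [y01|yN] := boolP (- 2^-1 <= x <= 2^-1).
  - transitivity (\int[mu]_y ((fun s : R => (F (x, s))%:E) \_ I) y)%E.
      apply: eq_integral => y _; rewrite !patchE; congr (if _ then _ else _).
      by apply/asbool_equiv_eq; split => [[]|h]//; split => //=; rewrite in_itv.
    rewrite -integral_mkcond -[LHS]fineK; first by have := F0 _ y01; rewrite /Rintegral => ->.
    apply: integrable_fin_num => //; first exact: measurable_itv.
    apply: (@mbd_integrable_cc _ _ _ (fun s => F (x, s))).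
    have [mF [M FM]] := bF; split.
      apply: (measurableT_comp mF).
      by apply/measurable_fun_pairP; split; [exact: measurable_cst|exact: measurable_id].
    by exists M => y xI; apply: FM; split => //=; rewrite in_itv.
  - apply: integral0_eq => y _; rewrite patchE ifF//; apply/negbTE/negP.
    by rewrite inE => -[/= + _]; rewrite in_itv /= (negbTE yN).
Qed.
Lemma mbd_fst (f : R -> R) : mbd Ix f ->
  mbd cell (fun p => f p.1).
Proof.
move=> [mf [M fM]]; split; first exact: measurableT_comp mf measurable_fst.
by exists M => -[x y] [/= + _]; exact: fM.
Qed.

Lemma mbd_snd (f : R -> R) : mbd Iy f -> mbd cell (fun p => f p.2).
Proof.
move=> [mf [M fM]]; split; first exact: measurableT_comp mf measurable_snd.
by exists M => -[x y] [/= _ +]; exact: fM.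
Qed.

(** Only the difference of the two boundary terms occurs. Asking that it vanish covers at once
    periodic data, test functions that vanish on the boundary, and a factor f that vanishes at both
    ends. *)
Lemma tensor_ibp_x (f f' h : R -> R) (phi phi1 phi2 : R * R -> R) :
  weak_derive (- 2^-1) 2^-1 f f' -> mbd Iy h -> C1 phi phi1 phi2 ->
  (forall y, 0 <= y <= 1 ->
     f 2^-1 * phi (2^-1, y) = f (- 2^-1) * phi (- 2^-1, y)) ->
  \int[leb2 R]_(p in cell) (f p.1 * h p.2 * phi1 p + f' p.1 * h p.2 * phi p) = 0.
Proof.
move=> [bf bf' ibp] bh [cphi cphi1 _ d1 _] bd.
apply: cell_integral0_x.
  by apply: mbdD; (apply: mbdM; last exact: continuous_mbd_cell);
    apply: mbdM; (try exact: mbd_snd); exact: mbd_fst.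
move=> y y01 /=.
have cy (g : R * R -> R) : continuous g -> continuous (fun s => g (s, y)).
  move=> cg s; apply: (@continuous_comp _ _ _ (fun s => (s, y)) g); last exact: cg.
  exact: (@cvg_pair _ _ _ (nbhs s) (nbhs s) (nbhs y) _ _ _ id (fun=> y)
    cvg_id (cvg_cst _)).
have -> : (fun x => f x * h y * phi1 (x, y) + f' x * h y * phi (x, y)) =
    (fun x => h y * (f x * phi1 (x, y) + f' x * phi (x, y))).
  by apply/funext => x; ring.
have bphi := mbd_continuous (- 2^-1) 2^-1 (cy _ cphi).
have bphi1 := mbd_continuous (- 2^-1) 2^-1 (cy _ cphi1).
rewrite RintegralZl//.
- rewrite (ibp (fun s => phi (s, y)) (fun s => phi1 (s, y)))//; last exact: cy.
  by rewrite bd// subrr mulr0.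
- by apply: mbd_integrable_cc; apply: mbdD; exact: mbdM.
Qed.

Lemma tensor_ibp_y (f h h' : R -> R) (phi phi1 phi2 : R * R -> R) :
  mbd Ix f -> weak_derive 0 1 h h' -> C1 phi phi1 phi2 ->
  (forall x, - 2^-1 <= x <= 2^-1 -> h 1 * phi (x, 1) = h 0 * phi (x, 0)) ->
  \int[leb2 R]_(p in cell) (f p.1 * h p.2 * phi2 p + f p.1 * h' p.2 * phi p) = 0.
Proof.
move=> bf [bh bh' ibp] [cphi _ cphi2 _ d2] bd.
apply: cell_integral0_y.
  by apply: mbdD; (apply: mbdM; last exact: continuous_mbd_cell);
    apply: mbdM; (try exact: mbd_snd); exact: mbd_fst.
move=> x x01 /=.
have cx (g : R * R -> R) : continuous g -> continuous (fun s => g (x, s)).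
  move=> cg s; apply: (@continuous_comp _ _ _ (fun s => (x, s)) g); last exact: cg.
  exact: (@cvg_pair _ _ _ (nbhs s) (nbhs x) (nbhs s) _ _ _ (fun=> x) id
    (cvg_cst _) cvg_id).
have -> : (fun y => f x * h y * phi2 (x, y) + f x * h' y * phi (x, y)) =
    (fun y => f x * (h y * phi2 (x, y) + h' y * phi (x, y))).
  by apply/funext => y; ring.
have bphi := mbd_continuous 0 1 (cx _ cphi).
have bphi2 := mbd_continuous 0 1 (cx _ cphi2).
rewrite RintegralZl//.
- rewrite (ibp (fun s => phi (x, s)) (fun s => phi2 (x, s)))//; last exact: cx.
  by rewrite bd// subrr mulr0.
- by apply: mbd_integrable_cc; apply: mbdD; exact: mbdM.
Qed.
End Cell.

(** * Products of a function of x and a function of y *)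

Section Tensor.
Variable R : realType.
Notation cell := (cell R).
Notation Ix := `[(- 2^-1 : R), (2^-1 : R)]%classic.
Notation Iy := `[(0 : R), (1 : R)]%classic.
Implicit Types (X : R -> R[i]) (Y : R -> R).

Definition tensor X Y : field_on_plane R := fun p =>
  Complex (complex.Re (X p.1) * Y p.2) (complex.Im (X p.1) * Y p.2).

Definition cmbd d (T : measurableType d) (D : set T) (u : T -> R[i]) :=
  mbd D (fun p => complex.Re (u p)) /\ mbd D (fun p => complex.Im (u p)).

Definition cweak_derive (a b : R) X X' :=
  weak_derive a b (fun x => complex.Re (X x)) (fun x => complex.Re (X' x)) /\
  weak_derive a b (fun x => complex.Im (X x)) (fun x => complex.Im (X' x)).

Lemma cmbd_L2 (u : field_on_plane R) : cmbd cell u -> L2 u.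
Proof.
move=> [br bi]; split.
- exact: measurable_funS br.1.
- exact: measurable_funS bi.1.
- apply: (@cell_integrable _ (fun p => sqmod (u p))).
  by rewrite /sqmod; apply: mbdD; exact: mbdM.
Qed.

Lemma cmbd_tensor X Y : cmbd Ix X -> mbd Iy Y -> cmbd cell (tensor X Y).
Proof.
move=> [bX1 bX2] bY; split; apply: mbdM; try exact: mbd_snd.
  exact: (@mbd_fst _ (fun x => complex.Re (X x))).
exact: (@mbd_fst _ (fun x => complex.Im (X x))).
Qed.

Lemma cweak_derive_cmbd X X' : cweak_derive (- 2^-1) 2^-1 X X' -> cmbd Ix X /\ cmbd Ix X'.
Proof. by move=> [[? ? _] [? ? _]]. Qed.

(* The boundary terms in the integrations by parts vanish. *)
Definition compatible_x (P : (R * R -> R) -> Prop) X := forall phi, P phi ->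
  forall y, 0 <= y <= 1 ->
  complex.Re (X 2^-1) * phi (2^-1, y) = complex.Re (X (- 2^-1)) * phi (- 2^-1, y) /\
  complex.Im (X 2^-1) * phi (2^-1, y) = complex.Im (X (- 2^-1)) * phi (- 2^-1, y).

Definition compatible_y (P : (R * R -> R) -> Prop) Y := forall phi, P phi ->
  forall x, - 2^-1 <= x <= 2^-1 -> Y 1 * phi (x, 1) = Y 0 * phi (x, 0).

Lemma cintegral_eqN (u1 u2 : field_on_plane R) (phi1 phi2 : R * R -> R) :
  cmbd cell u1 -> cmbd cell u2 -> mbd cell phi1 -> mbd cell phi2 ->
  \int[leb2 R]_(p in cell) (complex.Re (u1 p) * phi1 p + complex.Re (u2 p) * phi2 p) = 0 ->
  \int[leb2 R]_(p in cell) (complex.Im (u1 p) * phi1 p + complex.Im (u2 p) * phi2 p) = 0 ->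
  cintegral (fun p => u1 p * Complex (phi1 p) 0) =
  - cintegral (fun p => u2 p * Complex (phi2 p) 0).
Proof.
move=> [b1r b1i] [b2r b2i] bp1 bp2 hr hi.
have hM : forall u : field_on_plane R, forall phi : R * R -> R,
    cintegral (fun p => u p * Complex (phi p) 0) =
    Complex (\int[leb2 R]_(p in cell) (complex.Re (u p) * phi p))
            (\int[leb2 R]_(p in cell) (complex.Im (u p) * phi p)).
  move=> u phi; rewrite /cintegral; congr Complex; apply: eq_Rintegral => p _.
    by case: (u p) => a b /=; ring.
  by case: (u p) => a b /=; ring.
have key (f1 f2 : R * R -> R) : mbd cell f1 -> mbd cell f2 ->
    \int[leb2 R]_(p in cell) (f1 p * phi1 p + f2 p * phi2 p) = 0 ->
    \int[leb2 R]_(p in cell) (f1 p * phi1 p) = - \int[leb2 R]_(p in cell) (f2 p * phi2 p).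
  move=> b1 b2; rewrite RintegralD; first by move/eqP; rewrite addr_eq0 => /eqP.
  - exact: measurable_cell.
  - by apply: cell_integrable; exact: mbdM.
  - by apply: cell_integrable; exact: mbdM.
by rewrite !hM (key _ _ b1r b2r hr) (key _ _ b1i b2i hi).
Qed.

Lemma weak_grad_tensor P X X1 Y Y1 :
  cweak_derive (- 2^-1) 2^-1 X X1 -> weak_derive 0 1 Y Y1 ->
  compatible_x P X -> compatible_y P Y ->
  weak_grad P (tensor X Y) (tensor X1 Y) (tensor X Y1).
Proof.
move=> cX cY hX hY; have [bX bX1] := cweak_derive_cmbd cX; have [bY bY1 _] := cY.
have bt := cmbd_tensor bX bY; have bt1 := cmbd_tensor bX1 bY.
have bt2 := cmbd_tensor bX bY1.
split; [exact: cmbd_L2|exact: cmbd_L2|exact: cmbd_L2|].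
move=> phi phi1 phi2 cphi Pphi; have [c0 c1 c2 _ _] := cphi.
have [cXr cXi] := cX; have [bXr bXi] := bX.
split; apply: cintegral_eqN => //; try exact: continuous_mbd_cell.
- by apply: (tensor_ibp_x cXr bY cphi) => y /(hX _ Pphi)[].
- by apply: (tensor_ibp_x cXi bY cphi) => y /(hX _ Pphi)[].
- by apply: (tensor_ibp_y bXr cY cphi); exact: hY.
- by apply: (tensor_ibp_y bXi cY cphi); exact: hY.
Qed.

(** The integrand is the divergence of (X1 Y phi, X Y1 phi). Its flux is zero without any condition
    on phi, since X1 vanishes on the vertical sides and Y1 on the horizontal ones. *)
Lemma neumann_tensor X X1 X2 Y Y1 Y2 :
  cweak_derive (- 2^-1) 2^-1 X X1 -> cweak_derive (- 2^-1) 2^-1 X1 X2 ->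
  weak_derive 0 1 Y Y1 -> weak_derive 0 1 Y1 Y2 ->
  X1 (- 2^-1) = 0 -> X1 2^-1 = 0 -> Y1 0 = 0 -> Y1 1 = 0 ->
  zero_normal_derivative (tensor X1 Y) (tensor X Y1)
    (fun p => tensor X2 Y p + tensor X Y2 p).
Proof.
move=> cX cX1 cY cY1 Xl Xr Yl Yr phi phi1 phi2 cphi.
have [c0 c1 c2 _ _] := cphi.
have [bX bX1] := cweak_derive_cmbd cX; have [_ bX2] := cweak_derive_cmbd cX1.
have [bY bY1 _] := cY; have [_ bY2 _] := cY1.
have [cX1r cX1i] := cX1; have [bXr bXi] := bX.
have [bX1r bX1i] := bX1; have [bX2r bX2i] := bX2.
have key (f f1 f2 : R -> R) : mbd Ix f -> weak_derive (- 2^-1) 2^-1 f1 f2 ->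
    f1 2^-1 = 0 -> f1 (- 2^-1) = 0 ->
  \int[leb2 R]_(p in cell) ((f1 p.1 * Y p.2 * phi1 p + f2 p.1 * Y p.2 * phi p) +
    (f p.1 * Y1 p.2 * phi2 p + f p.1 * Y2 p.2 * phi p)) = 0.
  move=> bf cf f1r f1l; have [bf1 bf2 _] := cf.
  rewrite RintegralD; [|exact: measurable_cell|..].
  - rewrite (tensor_ibp_x cf bY cphi) ?add0r ?(tensor_ibp_y bf cY1 cphi)//.
      by move=> x _; rewrite Yl Yr !mul0r.
    by move=> y _; rewrite f1l f1r !mul0r.
  - by apply: cell_integrable; apply: mbdD; (apply: mbdM; last exact: continuous_mbd_cell);
      apply: mbdM; (try exact: mbd_snd); exact: mbd_fst.
  - by apply: cell_integrable; apply: mbdD; (apply: mbdM; last exact: continuous_mbd_cell);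
      apply: mbdM; (try exact: mbd_snd); exact: mbd_fst.
have kr := key _ _ _ bXr cX1r; have ki := key _ _ _ bXi cX1i.
rewrite Xl Xr /= in kr ki; have {}kr := kr erefl erefl; have {}ki := ki erefl erefl.
rewrite /cintegral -[RHS]/(Complex 0 0).
congr Complex; [rewrite -[RHS]kr|rewrite -[RHS]ki];
  apply: eq_Rintegral => p _ /=; ring.
Qed.
End Tensor.

(** * Truncation near the endpoints of an interval *)

Section Truncation.
Variable R : realType.
Implicit Types (x a b d : R) (f g : R -> R).

(** The middle piece is the cubic Hermite polynomial from 0 to 1 with zero slope at both ends, so
    that the function is C^1, the regularity asked of test functions. *)
Definition smoothstep : R -> R :=
  glue 0 (fun=> 0) (glue 1 (fun x => 3 * x ^+ 2 - 2 * x ^+ 3) (fun=> 1)).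
Definition smoothstep' : R -> R :=
  glue 0 (fun=> 0) (glue 1 (fun x => 6 * x - 6 * x ^+ 2) (fun=> 0)).

Lemma is_derive_smoothstep x : is_derive x 1 smoothstep (smoothstep' x).
Proof.
have d0 (c : R) x0 : is_derive x0 1 (fun _ : R => c) 0 by exact: is_derive_cst.
have dP x0 : is_derive x0 1 (glue 1 (fun x => 3 * x ^+ 2 - 2 * x ^+ 3) (fun=> 1))
    (glue 1 (fun x => 6 * x - 6 * x ^+ 2) (fun=> 0) x0).
  refine (@is_derive_glue _ _ (fun=> 1) _ (fun=> 0) 1 _ (d0 1) _ _ x0); [|ring..].
  by move=> x1; apply: is_derive_eq; rewrite /GRing.scale /=; ring.
refine (@is_derive_glue _ (fun=> 0) _ (fun=> 0) _ 0 (d0 0) dP _ _ x);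
  by rewrite /glue ltr01; ring.
Qed.

Lemma continuous_smoothstep' : continuous smoothstep'.
Proof.
have cc (c : R) : continuous (fun _ : R => c) by move=> ?; exact: cvg_cst.
apply: continuous_glue; [exact: cc|apply: continuous_glue; [|exact: cc|by ring]|].
  move=> x; apply: continuousB; apply: continuousM;
    [exact: cc|exact: cvg_id|exact: cc|exact: exprn_continuous].
by rewrite /glue ltr01; ring.
Qed.

Lemma smoothstep_le0 x : x <= 0 -> smoothstep x = 0 /\ smoothstep' x = 0.
Proof.
rewrite /smoothstep /smoothstep' /glue le_eqVlt => /predU1P[->|->//].
by rewrite ltxx ltr01; split; ring.
Qed.

Lemma smoothstep_ge1 x : 1 <= x -> smoothstep x = 1 /\ smoothstep' x = 0.
Proof.
move=> x1; have x0 : 0 <= x by exact: le_trans x1.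
by rewrite /smoothstep /smoothstep' /glue ltNge x0 ltNge x1.
Qed.

Lemma smoothstep_bound x : `|smoothstep x| <= 1 /\ `|smoothstep' x| <= 2.
Proof.
rewrite /smoothstep /smoothstep' /glue; case: ltP => [_|x0]; first by rewrite normr0.
case: ltP => [x1|_]; last by rewrite normr0 normr1.
have e1 : 0 <= (1 - x) ^+ 2 * (1 + 2 * x) by rewrite mulr_ge0 ?sqr_ge0//; lra.
have e2 : 0 <= x ^+ 2 * (3 - 2 * x) by rewrite mulr_ge0 ?sqr_ge0//; lra.
have e3 : 0 <= x * (1 - x) by rewrite mulr_ge0 ?subr_ge0// ltW.
have e4 := sqr_ge0 (x - 2^-1).
by rewrite !ler_norml; split; apply/andP; split; lra.
Qed.

(** The point is that [M] does not depend on [d]. A cutoff at scale d has slope of order 1 / d, but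
    where it varies f is at most K times the distance to the nearest endpoint, hence of order d,
    because f vanishes at both endpoints. *)
Lemma truncate_C1 (a b : R) f f' : a < b -> continuous f' ->
  (forall x, is_derive x 1 f (f' x)) -> f a = 0 -> f b = 0 ->
  exists2 M, 0 <= M & forall d, 0 < d -> exists g g' : R -> R,
  [/\ continuous g', (forall x, is_derive x 1 g (g' x)),
      (forall x, x <= a + d \/ b - d <= x -> g x = 0),
      (forall x, a <= x <= b -> `|g x| <= M /\ `|g' x| <= M) &
      (forall x, a + 2 * d <= x <= b - 2 * d -> g x = f x /\ g' x = f' x)].
Proof.
move=> ab cf' df fa fb.
have [_ [K fK]] := mbd_continuous a b cf'.
have cf := is_derive_continuous df.
have K0 : 0 <= K.
  by apply: le_trans (normr_ge0 (f' a)) (fK a _); rewrite /= in_itv /= lexx ltW.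
have lip x y : a <= x -> x <= y -> y <= b -> `|f y - f x| <= K * (y - x).
  move=> ax xy yb.
  have [c] := MVT_segment xy (fun x _ => df x) (continuous_subspaceT cf).
  rewrite in_itv /= => /andP[xc cy] ->; rewrite normrM (ger0_norm (_ : 0 <= y - x)) ?subr_ge0//.
  rewrite ler_wpM2r ?subr_ge0// fK//= in_itv /=; apply/andP; split; lra.
have fl x : a <= x <= b -> `|f x| <= K * (x - a).
  by move=> /andP[ax xb]; have := lip _ _ (lexx a) ax xb; rewrite fa subr0.
have fr x : a <= x <= b -> `|f x| <= K * (b - x).
  by move=> /andP[ax xb]; have := lip _ _ ax xb (lexx b); rewrite fb sub0r normrN.
(* K (b - a) bounds g. For g', each of the two cutoffs contributes (2 / d) (2 d K) = 4 K, and the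
   term in f' contributes K. *)
exists (K * (b - a) + 9 * K) => [|d d0].
  by rewrite addr_ge0 ?mulr_ge0// subr_ge0 ltW.
(* S (u x) is 0 for x <= a + d and 1 for x >= a + 2 d; S (v x) is its mirror image at b. *)
pose u x := (x - a) / d - 1; pose v x := (b - x) / d - 1.
pose S := smoothstep; pose S' := smoothstep'.
pose g x := S (u x) * (S (v x) * f x).
pose g' x := S' (u x) / d * (S (v x) * f x) +
  S (u x) * (- (S' (v x) / d) * f x + S (v x) * f' x).
have du x : is_derive x 1 u d^-1.
  by apply: is_derive_eq; rewrite /GRing.scale /=; ring.
have dv x : is_derive x 1 v (- d^-1).
  by apply: is_derive_eq; rewrite /GRing.scale /=; ring.
have dSu x : is_derive x 1 (S \o u) (S' (u x) * d^-1).
  exact: is_derive1_comp (is_derive_smoothstep _) (du x).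
have dSv x : is_derive x 1 (S \o v) (S' (v x) * - d^-1).
  exact: is_derive1_comp (is_derive_smoothstep _) (dv x).
have cSu := is_derive_continuous dSu; have cSv := is_derive_continuous dSv.
have cS'u : continuous (S' \o u).
  by move=> x; apply: continuous_comp; [exact: (is_derive_continuous du)|exact: continuous_smoothstep'].
have cS'v : continuous (S' \o v).
  by move=> x; apply: continuous_comp; [exact: (is_derive_continuous dv)|exact: continuous_smoothstep'].
have dg x : is_derive x 1 g (g' x).
  have h1 := dSu x; have h2 := dSv x; have h3 := df x.
  have -> : g = (S \o u) * ((S \o v) * f) by apply/funext.
  by apply: is_derive_eq; rewrite /g' /GRing.scale /= ?fctE /=; ring.
have uE x : u x * d = x - a - d by rewrite /u; field; rewrite gt_eqF.
have vE x : v x * d = b - x - d by rewrite /v; field; rewrite gt_eqF.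
exists g, g'; split => //.
- move=> x.
  have cc : continuous (fun _ : R => d^-1) by move=> ?; exact: cvg_cst.
  apply: cvgD; apply: cvgM.
  + by apply: cvgM; [exact: cS'u|exact: cc].
  + by apply: cvgM; [exact: cSv|exact: cf].
  + exact: cSu.
  + apply: cvgD; apply: cvgM; [|exact: cf|exact: cSv|exact: cf'].
    by apply: cvgN; apply: cvgM; [exact: cS'v|exact: cc].
- move=> x [xa|xb]; rewrite /g.
    have u0 : u x <= 0 by rewrite -(pmulr_lle0 _ d0) uE; lra.
    by rewrite /S (smoothstep_le0 u0).1 mul0r.
  have v0 : v x <= 0 by rewrite -(pmulr_lle0 _ d0) vE; lra.
  by rewrite /S (smoothstep_le0 v0).1 mul0r mulr0.
- move=> x xab; have [Su S'u] := smoothstep_bound (u x).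
  have [Sv S'v] := smoothstep_bound (v x).
  have fK1 := fl _ xab; have fK2 := fr _ xab; have f0 := normr_ge0 (f x).
  have f'K : `|f' x| <= K by apply: fK; rewrite /= in_itv.
  have t1 : `|S' (u x) / d * f x| <= 4 * K.
    have [u1|u1] := leP 1 (u x).
      by rewrite /S' (smoothstep_ge1 u1).2 !mul0r normr0 mulr_ge0.
    have xa : x - a <= 2 * d.
      by move: u1; rewrite -(ltr_pM2r d0) uE; lra.
    rewrite !normrM normfV (gtr0_norm d0).
    have -> : 4 * K = 2 / d * (K * (2 * d)) by field; rewrite gt_eqF.
    rewrite ler_pM ?mulr_ge0 ?invr_ge0 ?(ltW d0)//.
      by rewrite ler_wpM2r// invr_ge0 ltW.
    by apply: (le_trans fK1); rewrite ler_wpM2l.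
  have t2 : `|S' (v x) / d * f x| <= 4 * K.
    have [u1|u1] := leP 1 (v x).
      by rewrite /S' (smoothstep_ge1 u1).2 !mul0r normr0 mulr_ge0.
    have xa : b - x <= 2 * d.
      by move: u1; rewrite -(ltr_pM2r d0) vE; lra.
    rewrite !normrM normfV (gtr0_norm d0).
    have -> : 4 * K = 2 / d * (K * (2 * d)) by field; rewrite gt_eqF.
    rewrite ler_pM ?mulr_ge0 ?invr_ge0 ?(ltW d0)//.
      by rewrite ler_wpM2r// invr_ge0 ltW.
    by apply: (le_trans fK2); rewrite ler_wpM2l.
  have le1 (s t : R) : `|s| <= 1 -> `|s * t| <= `|t|.
    by move=> s1; rewrite normrM ler_piMl.
  split.
    apply: (le_trans (le1 _ _ Su)); apply: (le_trans (le1 _ _ Sv)).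
    have : K * (x - a) <= K * (b - a) by rewrite ler_wpM2l//; lra.
    by clear -fK1 K0; lra.
  have -> : g' x = S (v x) * (S' (u x) / d * f x) +
      S (u x) * (- (S' (v x) / d * f x) + S (v x) * f' x) by rewrite /g'; ring.
  apply: (le_trans (ler_normD _ _)).
  have e1 := le_trans (le1 _ (S' (u x) / d * f x) Sv) t1.
  have e2 := le1 _ (- (S' (v x) / d * f x) + S (v x) * f' x) Su.
  have e3 := ler_normD (- (S' (v x) / d * f x)) (S (v x) * f' x).
  have e4 := le_trans (le1 _ (f' x) Sv) f'K.
  rewrite normrN in e3.
  have e5 : 0 <= K * (b - a) by rewrite mulr_ge0// subr_ge0 ltW.
  by clear -e1 e2 e3 e4 e5 t2; lra.
- move=> x /andP[xa xb].
  have u1 : 1 <= u x by rewrite -(ler_pM2r d0) uE; lra.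
  have v1 : 1 <= v x by rewrite -(ler_pM2r d0) vE; lra.
  rewrite /g /g' /S /S'; have [-> ->] := smoothstep_ge1 u1.
  by have [-> ->] := smoothstep_ge1 v1; split; ring.
Qed.
End Truncation.

(** * Upper and lower bounds for L^2 norms *)

Section L2Estimates.
Variable R : realType.
Notation cell := (cell R).
Implicit Types (u w : field_on_plane R).

Definition rect (a b c d : R) : set (R * R) := `[a, b]%classic `*` `[c, d]%classic.

Lemma measurable_rect a b c d : measurable (rect a b c d).
Proof. by apply: measurableX; exact: measurable_itv. Qed.

Lemma rect_cell (a b c d : R) : - 2^-1 <= a -> b <= 2^-1 -> 0 <= c -> d <= 1 ->
  rect a b c d `<=` cell.
Proof.
move=> ha hb hc hd [x y] [/=]; rewrite !in_itv /= => /andP[x1 x2] /andP[y1 y2].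
by split; rewrite /= in_itv /=; apply/andP; split;
  [exact: le_trans x1|exact: le_trans hb|exact: le_trans y1|exact: le_trans hd].
Qed.

Lemma mbd_indic (A : set (R * R)) : measurable A -> mbd cell (\1_A : R * R -> R).
Proof.
move=> mA; split; first exact: measurable_indic.
by exists 1 => p _; rewrite indicE; case: (p \in A); rewrite ?normr1 ?normr0.
Qed.

Lemma Rintegral_indic_rect (a b c d : R) : a <= b -> c <= d ->
  - 2^-1 <= a -> b <= 2^-1 -> 0 <= c -> d <= 1 ->
  \int[leb2 R]_(p in cell) \1_(rect a b c d) p = (b - a) * (d - c).
Proof.
move=> ab cd ha hb hc hd.
rewrite /Rintegral integral_indic; [|exact: measurable_cell|exact: measurable_rect].
by rewrite (setIidl (rect_cell ha hb hc hd)) [X in fine X](measure_rect ab cd).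
Qed.

Lemma cmbd_sqmod u : cmbd cell u -> mbd cell (fun p => sqmod (u p)).
Proof. by move=> [br bi]; rewrite /sqmod; apply: mbdD; exact: mbdM. Qed.

Lemma sqmod_ge0 (z : R[i]) : 0 <= sqmod z.
Proof. by rewrite addr_ge0 ?sqr_ge0. Qed.

(** The support lies in a border of area 1 - (1 - 2 eta)^2 <= 4 eta. *)
Lemma L2norm_small u (M eta : R) : cmbd cell u -> 0 < eta -> eta <= 2^-1 -> 0 <= M ->
  (forall p, cell p -> sqmod (u p) <= M) ->
  (forall p, rect (- 2^-1 + eta) (2^-1 - eta) eta (1 - eta) p -> u p = 0) ->
  L2norm u ^+ 2 <= 4 * M * eta.
Proof.
move=> bu eta0 eta2 M0 uM u0.
have mr := measurable_rect (- 2^-1 + eta) (2^-1 - eta) eta (1 - eta).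
rewrite sqr_sqrtr; last by apply: Rintegral_ge0 => p _; exact: sqmod_ge0.
apply: (@le_trans _ _ (\int[leb2 R]_(p in cell)
   (M * (1 + - \1_(rect (- 2^-1 + eta) (2^-1 - eta) eta (1 - eta)) p)))).
  apply: le_Rintegral; [exact: measurable_cell|..].
  - by apply: cell_integrable; exact: cmbd_sqmod.
  - apply: cell_integrable; apply: mbdM; first exact: mbd_cst.
    by apply: mbdD; [exact: mbd_cst|apply: mbdN; exact: mbd_indic].
  - move=> p cp; rewrite indicE; have [/set_mem pr|_] := boolP (p \in _).
      by rewrite u0// /sqmod /= expr0n addr0 subrr mulr0.
    by rewrite oppr0 addr0 mulr1 uM.
rewrite RintegralZl; [|exact: measurable_cell|]; last first.
  apply: cell_integrable; apply: mbdD; first exact: mbd_cst.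
  by apply: mbdN; exact: mbd_indic.
rewrite RintegralB; [|exact: measurable_cell|by apply: cell_integrable; exact: mbd_cst
  |by apply: cell_integrable; exact: mbd_indic].
rewrite Rintegral_indic_rect ?Rintegral_cst; try lra; last exact: measurable_cell.
have mc : (leb2 R) cell = 1%:E.
  by rewrite /cell measure_rect; [congr (_%:E); lra|lra|lra].
rewrite [X in fine X]mc.
rewrite /=; have := mulr_ge0 M0 (ltW eta0); have := mulr_ge0 M0 (sqr_ge0 eta).
nra.
Qed.

Lemma L2norm_gt0 u (a b c d m : R) : cmbd cell u -> 0 < m -> a < b -> c < d ->
  - 2^-1 <= a -> b <= 2^-1 -> 0 <= c -> d <= 1 ->
  (forall p, rect a b c d p -> m <= sqmod (u p)) -> 0 < L2norm u.
Proof.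
move=> bu m0 ab cd ha hb hc hd um; rewrite sqrtr_gt0.
have mr := measurable_rect a b c d.
apply: (@lt_le_trans _ _ (\int[leb2 R]_(p in cell) (m * \1_(rect a b c d) p))).
  rewrite RintegralZl; [|exact: measurable_cell|by apply: cell_integrable; exact: mbd_indic].
  by rewrite (Rintegral_indic_rect (ltW ab) (ltW cd))// !mulr_gt0// subr_gt0.
apply: le_Rintegral; [exact: measurable_cell|..].
- by apply: cell_integrable; apply: mbdM; [exact: mbd_cst|exact: mbd_indic].
- by apply: cell_integrable; exact: cmbd_sqmod.
- move=> p cp; rewrite indicE; have [/set_mem pr|_] := boolP (p \in _).
    by rewrite mulr1 um.
  by rewrite mulr0 sqmod_ge0.
Qed.

Lemma continuous_gt0_near (f : R -> R) (x0 r : R) : continuous f -> 0 < f x0 ->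
  0 < r -> exists2 d, 0 < d <= r &
    forall x, x0 - d <= x <= x0 + d -> f x0 / 2 <= f x.
Proof.
move=> cf f0 r0; have f2 : 0 < f x0 / 2 by rewrite divr_gt0.
have /cvgrPdist_le/(_ _ f2)/nbhs_ballP[e /= e0 he] := cf x0.
have m0 : 0 < Num.min (e / 2) r by rewrite lt_min divr_gt0.
exists (Num.min (e / 2) r); first by rewrite m0 ge_min lexx orbT.
move=> x /andP[x1 x2].
have me : Num.min (e / 2) r <= e / 2 by rewrite ge_min lexx.
have : `|f x0 - f x| <= f x0 / 2.
  by apply: he; rewrite /ball /= ltr_distl; apply/andP; split; lra.
by rewrite ler_norml => /andP[h1 h2]; lra.
Qed.

Lemma L2norm_tensor_gt0 (X : R -> R[i]) (Y : R -> R) (y0 : R) :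
  continuous (fun x => complex.Re (X x)) -> continuous (fun x => complex.Im (X x)) ->
  continuous Y -> X 0 != 0 -> 0 < y0 < 1 -> Y y0 != 0 ->
  0 < L2norm (tensor X Y).
Proof.
move=> cr ci cY X0 /andP[y0p y1p] Yy.
have cs (f : R -> R) : continuous f -> continuous (fun x => f x ^+ 2).
  by move=> cf x; apply: cvgM; exact: cf.
have cX2 : continuous (fun x => sqmod (X x)).
  by move=> x; apply: cvgD; exact: cs.
have X2 : 0 < sqmod (X 0).
  rewrite lt_neqAle sqmod_ge0 andbT eq_sym; apply: contra X0.
  rewrite paddr_eq0 ?sqr_ge0// !sqrf_eq0 => /andP[/eqP hr /eqP hi].
  by rewrite eq_complex hr hi !eqxx.
have Y2 : 0 < Y y0 ^+ 2 by rewrite exprn_even_gt0.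
have h2 : 0 < 2^-1 :> R by lra.
have [d /andP[d0 d2] hX] := continuous_gt0_near cX2 X2 h2.
have m0 : 0 < Num.min y0 (1 - y0) by rewrite lt_min y0p subr_gt0.
have [e /andP[e0] + hY] := continuous_gt0_near (cs _ cY) Y2 m0.
rewrite le_min => /andP[e1 e2].
apply: (@L2norm_gt0 _ (- d) d (y0 - e) (y0 + e) (sqmod (X 0) / 2 * (Y y0 ^+ 2 / 2)));
  try lra.
- apply: cmbd_tensor; last exact: mbd_continuous.
  by split; exact: mbd_continuous.
- by rewrite mulr_gt0 ?divr_gt0.
- move=> [x y] [/=]; rewrite !in_itv /= => xd ye.
  have -> : sqmod (tensor X Y (x, y)) = sqmod (X x) * Y y ^+ 2.
    by rewrite /sqmod /tensor /=; ring.
  by rewrite ler_pM ?divr_ge0 ?sqmod_ge0 ?sqr_ge0 ?hX ?hY// sub0r add0r.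
Qed.
End L2Estimates.

(** * Approximation by compactly supported products *)

Section Dirichlet.
Variable R : realType.
Notation cell := (cell R).

Lemma continuous_tensor (g k : R -> R) : continuous g -> continuous k ->
  continuous (fun p : R * R => g p.1 * k p.2).
Proof.
move=> cg ck p; apply: cvgM.
  by apply: (@continuous_comp _ _ _ fst g); [exact: cvg_fst|exact: cg].
by apply: (@continuous_comp _ _ _ snd k); [exact: cvg_snd|exact: ck].
Qed.

Lemma C1_tensor (g g' k k' : R -> R) : continuous g' -> continuous k' ->
  (forall x : R, is_derive x 1 g (g' x)) -> (forall x : R, is_derive x 1 k (k' x)) ->
  C1 (fun p => g p.1 * k p.2) (fun p => g' p.1 * k p.2) (fun p => g p.1 * k' p.2).
Proof.
move=> cg' ck' dg dk.
have cg := is_derive_continuous dg; have ck := is_derive_continuous dk.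
split; try exact: continuous_tensor.
- move=> x y /=; have h := dg x.
  by apply: is_derive_eq; rewrite /GRing.scale /=; ring.
- move=> x y /=; have h := dk y.
  by apply: is_derive_eq; rewrite /GRing.scale /=; ring.
Qed.

Lemma compact_test_tensor (g k : R -> R) (d : R) : 0 < d ->
  (forall x, x <= - 2^-1 + d \/ 2^-1 - d <= x -> g x = 0) ->
  (forall y, y <= 0 + d \/ 1 - d <= y -> k y = 0) ->
  compact_test (fun p => g p.1 * k p.2).
Proof.
move=> d0 g0 k0.
pose K := rect (- 2^-1 + d) (2^-1 - d) d (1 - d).
have cK : closed K.
  apply: compact_closed; first exact: norm_hausdorff.
  by apply: compact_setX; exact: segment_compact.
have sK : [set p | g p.1 * k p.2 != 0] `<=` K.
  move=> [x y] /=; rewrite mulf_eq0 negb_or => /andP[gx ky].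
  split; rewrite /= in_itv /=; apply/andP; split; rewrite leNgt; apply/negP => h.
  - by move: gx; rewrite g0 ?eqxx//; left; exact: ltW.
  - by move: gx; rewrite g0 ?eqxx//; right; exact: ltW.
  - by move: ky; rewrite k0 ?eqxx//; left; rewrite add0r; exact: ltW.
  - by move: ky; rewrite k0 ?eqxx//; right; exact: ltW.
apply: (@subset_trans _ K); first by rewrite [X in _ `<=` X](_ : K = closure K); [exact: closureS|exact/closure_id].
move=> [x y] [/=]; rewrite !in_itv /= => /andP[x1 x2] /andP[y1 y2].
by split; rewrite /= in_itv /=; apply/andP; split; lra.
Qed.

(** Real and imaginary parts are differences of two products bounded by M^2, so the square modulus
    is at most 8 M^4; it vanishes off a border of width 2 d, which gives 4 * 8 M^4 * 2 d = 64 M^4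
    d. *)
Lemma L2norm_tensorB_lt (f1 f2 g1 g2 h k : R -> R) (M d e : R) :
  0 < d -> d <= 4^-1 -> 0 <= M -> 0 < e -> 64 * M ^+ 4 * d < e ^+ 2 ->
  continuous f1 -> continuous f2 -> continuous g1 -> continuous g2 ->
  continuous h -> continuous k ->
  (forall x, - 2^-1 <= x <= 2^-1 ->
     [/\ `|f1 x| <= M, `|f2 x| <= M, `|g1 x| <= M & `|g2 x| <= M]) ->
  (forall y, 0 <= y <= 1 -> `|h y| <= M /\ `|k y| <= M) ->
  (forall x, - 2^-1 + 2 * d <= x <= 2^-1 - 2 * d -> g1 x = f1 x /\ g2 x = f2 x) ->
  (forall y, 0 + 2 * d <= y <= 1 - 2 * d -> k y = h y) ->
  L2norm (fun p => Complex (f1 p.1 * h p.2) (f2 p.1 * h p.2) -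
                   Complex (g1 p.1 * k p.2) (g2 p.1 * k p.2)) < e.
Proof.
move=> d0 d4 M0 e0 small cf1 cf2 cg1 cg2 ch ck bx by_ ex ey.
set u := (fun p => _ - _).
have bu : cmbd cell u.
  by split; apply: mbdD => /=; (try apply: mbdN); apply: continuous_mbd_cell;
    exact: continuous_tensor.
have bnd (a b c d' : R) : `|a| <= M -> `|b| <= M -> `|c| <= M -> `|d'| <= M ->
    (a * b - c * d') ^+ 2 <= 4 * M ^+ 4.
  move=> ha hb hc hd; rewrite -real_normK ?num_real//.
  have h1 : `|a * b - c * d'| <= 2 * M ^+ 2.
    apply: (le_trans (ler_normB _ _)); rewrite !normrM.
    have -> : 2 * M ^+ 2 = M * M + M * M by ring.
    by rewrite lerD// ler_pM.
  have -> : 4 * M ^+ 4 = (2 * M ^+ 2) ^+ 2 by ring.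
  by rewrite lerXn2r ?nnegrE// mulr_ge0// sqr_ge0.
have d20 : 0 < 2 * d by rewrite mulr_gt0.
have d22 : 2 * d <= 2^-1 by lra.
have M4 : 0 <= 8 * M ^+ 4 by rewrite mulr_ge0// exprn_ge0.
have : L2norm u ^+ 2 <= 4 * (8 * M ^+ 4) * (2 * d).
  apply: L2norm_small => //.
  - move=> [x y] [/=]; rewrite !in_itv /= => /bx[? ? ? ?] /by_[? ?].
    have -> : 8 * M ^+ 4 = 4 * M ^+ 4 + 4 * M ^+ 4 by ring.
    by rewrite /sqmod /u /= lerD// bnd.
  - move=> [x y] [/=]; rewrite !in_itv /= => /ex[e1 e2] yy.
    by rewrite /u /= e1 e2 ey ?add0r// subrr.
move=> h1; rewrite -(ltr_pXn2r (_ : 0 < 2)%N) ?nnegrE ?sqrtr_ge0 ?ltW//.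
by apply: le_lt_trans small; clear -h1; lra.
Qed.

(** Each of the three real factors is truncated separately in its own variable. The approximants and
    both components of their gradients are again products, so one estimate handles the three
    norms. *)
Lemma H10_tensor (X X1 : R -> R[i]) (Y Y1 : R -> R) :
  continuous (fun x => complex.Re (X1 x)) -> continuous (fun x => complex.Im (X1 x)) ->
  continuous Y1 ->
  (forall x : R, is_derive x 1 (fun x => complex.Re (X x)) (complex.Re (X1 x))) ->
  (forall x : R, is_derive x 1 (fun x => complex.Im (X x)) (complex.Im (X1 x))) ->
  (forall y : R, is_derive y 1 Y (Y1 y)) ->
  X (- 2^-1) = 0 -> X 2^-1 = 0 -> Y 0 = 0 -> Y 1 = 0 ->
  H10 (tensor X Y) (tensor X1 Y) (tensor X Y1).
Proof.
move=> cXr1 cXi1 cY1 dXr dXi dY Xl Xr Yl Yr e e0.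
have lr : - 2^-1 < 2^-1 :> R by lra.
have [Mr Mr0 tr] := truncate_C1 lr cXr1 dXr (congr1 (@complex.Re R) Xl) (congr1 (@complex.Re R) Xr).
have [Mi Mi0 ti] := truncate_C1 lr cXi1 dXi (congr1 (@complex.Im R) Xl) (congr1 (@complex.Im R) Xr).
have [My My0 ty] := truncate_C1 ltr01 cY1 dY Yl Yr.
have cXr := is_derive_continuous dXr; have cXi := is_derive_continuous dXi.
have cY := is_derive_continuous dY.
have bd (f : R -> R) a b : continuous f -> exists2 N, 0 <= N &
    forall x, a <= x <= b -> `|f x| <= N.
  move=> cf; have [_ [N fN]] := mbd_continuous a b cf; exists (Num.max N 0).
    by rewrite le_max lexx orbT.
  by move=> x xab; rewrite le_max fN//= in_itv.
have [N1 N10 hN1] := bd _ (- 2^-1) 2^-1 cXr.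
have [N2 N20 hN2] := bd _ (- 2^-1) 2^-1 cXi.
have [N3 N30 hN3] := bd _ (- 2^-1) 2^-1 cXr1.
have [N4 N40 hN4] := bd _ (- 2^-1) 2^-1 cXi1.
have [N5 N50 hN5] := bd _ 0 1 cY.
have [N6 N60 hN6] := bd _ 0 1 cY1.
have [M [M1 hM]] : exists M : R, 1 <= M /\
    [/\ [/\ N1 <= M, N2 <= M & N3 <= M], [/\ N4 <= M, N5 <= M & N6 <= M] &
        [/\ Mr <= M, Mi <= M & My <= M]].
  exists (1 + N1 + N2 + N3 + N4 + N5 + N6 + Mr + Mi + My).
  by do !split; lra.
have [[m1 m2 m3] [m4 m5 m6] [m7 m8 m9]] := hM.
have M4 : 0 < 128 * M ^+ 4 by rewrite mulr_gt0// exprn_gt0// (lt_le_trans ltr01).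
have M0 : 0 <= M by exact: le_trans M1.
have e2 : 0 < e ^+ 2 by rewrite exprn_gt0.
(* Twice the constant of the estimate, so that the error is at most e^2 / 2 and the inequality is
   strict. *)
pose d := Num.min 4^-1 (e ^+ 2 / (128 * M ^+ 4)).
have d0 : 0 < d by rewrite lt_min invr_gt0 ltr0n divr_gt0.
have d4 : d <= 4^-1 by rewrite ge_min lexx.
have small : 64 * M ^+ 4 * d < e ^+ 2.
  have : d <= e ^+ 2 / (128 * M ^+ 4) by rewrite ge_min lexx orbT.
  by rewrite ler_pdivlMr// => h; clear -h e2; lra.
have [gr [gr' [cgr' dgr gr0 gr1 gr2]]] := tr _ d0.
have [gi [gi' [cgi' dgi gi0 gi1 gi2]]] := ti _ d0.
have [k [k' [ck' dk k0 k1 k2]]] := ty _ d0.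
have cgr := is_derive_continuous dgr; have cgi := is_derive_continuous dgi.
have ck := is_derive_continuous dk.
exists (fun p => gr p.1 * k p.2), (fun p => gr' p.1 * k p.2), (fun p => gr p.1 * k' p.2).
exists (fun p => gi p.1 * k p.2), (fun p => gi' p.1 * k p.2), (fun p => gi p.1 * k' p.2).
split; first by split; exact: C1_tensor.
  by split; [exact: compact_test_tensor d0 gr0 k0|exact: compact_test_tensor d0 gi0 k0].
split.
- apply: (@L2norm_tensorB_lt (fun x => complex.Re (X x)) (fun x => complex.Im (X x)) gr gi Y k M d) => //.
  + move=> x xI; have [a _] := gr1 _ xI; have [b _] := gi1 _ xI.
    by split; [exact: le_trans (hN1 _ xI) m1|exact: le_trans (hN2 _ xI) m2|
      exact: le_trans a m7|exact: le_trans b m8].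
  + move=> y yI; have [a _] := k1 _ yI.
    by split; [exact: le_trans (hN5 _ yI) m5|exact: le_trans a m9].
  + by move=> x xI; have [-> _] := gr2 _ xI; have [-> _] := gi2 _ xI.
  + by move=> y yI; have [-> _] := k2 _ yI.
- apply: (@L2norm_tensorB_lt (fun x => complex.Re (X1 x)) (fun x => complex.Im (X1 x)) gr' gi' Y k M d) => //.
  + move=> x xI; have [_ a] := gr1 _ xI; have [_ b] := gi1 _ xI.
    by split; [exact: le_trans (hN3 _ xI) m3|exact: le_trans (hN4 _ xI) m4|
      exact: le_trans a m7|exact: le_trans b m8].
  + move=> y yI; have [a _] := k1 _ yI.
    by split; [exact: le_trans (hN5 _ yI) m5|exact: le_trans a m9].
  + by move=> x xI; have [_ ->] := gr2 _ xI; have [_ ->] := gi2 _ xI.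
  + by move=> y yI; have [-> _] := k2 _ yI.
- apply: (@L2norm_tensorB_lt (fun x => complex.Re (X x)) (fun x => complex.Im (X x)) gr gi Y1 k' M d) => //.
  + move=> x xI; have [a _] := gr1 _ xI; have [b _] := gi1 _ xI.
    by split; [exact: le_trans (hN1 _ xI) m1|exact: le_trans (hN2 _ xI) m2|
      exact: le_trans a m7|exact: le_trans b m8].
  + move=> y yI; have [_ a] := k1 _ yI.
    by split; [exact: le_trans (hN6 _ yI) m6|exact: le_trans a m9].
  + by move=> x xI; have [-> _] := gr2 _ xI; have [-> _] := gi2 _ xI.
  + by move=> y yI; have [_ ->] := k2 _ yI.
Qed.
End Dirichlet.

(** * Solutions and their energy *)

Section Hilbert.
Variable R : realType.
Notation cell := (cell R).
Implicit Types (u v f g w : field_on_plane R) (c : R[i]).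

Lemma sqmodM (a b : R[i]) : sqmod (a * b) = sqmod a * sqmod b.
Proof. by case: a b => a1 a2 [b1 b2]; rewrite /sqmod /=; ring. Qed.

Lemma L2Z c u : L2 u -> L2 (fun p => c * u p).
Proof.
move=> [mr mi iu]; have mk (k : R) (h : R * R -> R) :
    measurable_fun cell h -> measurable_fun cell (fun p => k * h p).
  by move=> mh; apply: measurable_funM => //; exact: measurable_cst.
split.
- have -> : (fun p => complex.Re (c * u p)) =
      (fun p => complex.Re c * complex.Re (u p) - complex.Im c * complex.Im (u p)).
    by apply/funext => p; case: c (u p) => ? ? [].
  by apply: measurable_funB; exact: mk.
- have -> : (fun p => complex.Im (c * u p)) =
      (fun p => complex.Re c * complex.Im (u p) + complex.Im c * complex.Re (u p)).
    by apply/funext => p; case: c (u p) => ? ? [].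
  by apply: measurable_funD; exact: mk.
- have -> : (fun p => (sqmod (c * u p))%:E) = (fun p => (sqmod c)%:E * (sqmod (u p))%:E)%E.
    by apply/funext => p; rewrite sqmodM EFinM.
  by apply: integrableZl => //; exact: measurable_cell.
Qed.

Lemma L2normZ c u : L2 u -> L2norm (fun p => c * u p) = Num.sqrt (sqmod c) * L2norm u.
Proof.
move=> [_ _ iu]; rewrite /L2norm -sqrtrM ?sqmod_ge0//; congr Num.sqrt.
rewrite -RintegralZl//; last exact: measurable_cell.
by apply: eq_Rintegral => p _; rewrite sqmodM.
Qed.

(** Both parts are dominated by |f|^2 + |v|^2. Integrability is what makes the integrals in [inner]
    additive when a complex scalar mixes real and imaginary parts. *)
Lemma L2_mul_conj_integrable f v : L2 f -> L2 v ->
  (leb2 R).-integrable cell (EFin \o (fun p => complex.Re (f p * conjc (v p)))) /\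
  (leb2 R).-integrable cell (EFin \o (fun p => complex.Im (f p * conjc (v p)))).
Proof.
move=> [fr fi If] [vr vi Iv].
have Ifv : (leb2 R).-integrable cell (fun p => (sqmod (f p) + sqmod (v p))%:E).
  have -> : (fun p => (sqmod (f p) + sqmod (v p))%:E) =
    (fun p => ((sqmod (f p))%:E + (sqmod (v p))%:E))%E by apply/funext => p; rewrite EFinD.
  by apply: integrableD => //; exact: measurable_cell.
split.
- apply: le_integrable Ifv; first exact: measurable_cell.
    apply/measurable_EFinP.
    have -> : (fun p => complex.Re (f p * conjc (v p))) = (fun p =>
        complex.Re (f p) * complex.Re (v p) + complex.Im (f p) * complex.Im (v p)).
      by apply/funext => p; case: (f p) (v p) => ? ? [? ?] /=; ring.
    by apply: measurable_funD; exact: measurable_funM.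
  move=> p _; rewrite !abse_EFin lee_fin (ger0_norm (addr_ge0 (sqmod_ge0 _) (sqmod_ge0 _))).
  case: (f p) (v p) => a b [c d]; rewrite /sqmod /= ler_norml; apply/andP; split.
    have := sqr_ge0 (a + c); have := sqr_ge0 (b + d); have := sqr_ge0 a; have := sqr_ge0 b.
    have := sqr_ge0 c; have := sqr_ge0 d; nra.
  have := sqr_ge0 (a - c); have := sqr_ge0 (b - d); have := sqr_ge0 a; have := sqr_ge0 b.
  have := sqr_ge0 c; have := sqr_ge0 d; nra.
- apply: le_integrable Ifv; first exact: measurable_cell.
    apply/measurable_EFinP.
    have -> : (fun p => complex.Im (f p * conjc (v p))) = (fun p =>
        complex.Im (f p) * complex.Re (v p) - complex.Re (f p) * complex.Im (v p)).
      by apply/funext => p; case: (f p) (v p) => ? ? [? ?] /=; ring.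
    by apply: measurable_funB; exact: measurable_funM.
  move=> p _; rewrite !abse_EFin lee_fin (ger0_norm (addr_ge0 (sqmod_ge0 _) (sqmod_ge0 _))).
  case: (f p) (v p) => a b [c d]; rewrite /sqmod /= ler_norml; apply/andP; split.
    have := sqr_ge0 (a - d); have := sqr_ge0 (b + c); have := sqr_ge0 a; have := sqr_ge0 b.
    have := sqr_ge0 c; have := sqr_ge0 d; nra.
  have := sqr_ge0 (a + d); have := sqr_ge0 (b - c); have := sqr_ge0 a; have := sqr_ge0 b.
  have := sqr_ge0 c; have := sqr_ge0 d; nra.
Qed.

Lemma innerZr c f v : L2 f -> L2 v -> inner f (fun p => c * v p) = conjc c * inner f v.
Proof.
move=> Lf Lv; have [ir ii] := L2_mul_conj_integrable Lf Lv.
have iZ (k : R) (h : R * R -> R) : (leb2 R).-integrable cell (EFin \o h) ->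
    (leb2 R).-integrable cell (EFin \o (fun p => k * h p)).
  move=> ih; have -> : EFin \o (fun p => k * h p) = (fun p => k%:E * (EFin \o h) p)%E.
    by apply/funext => p /=; rewrite EFinM.
  by apply: integrableZl => //; exact: measurable_cell.
have mc := @measurable_cell R.
case: c => c1 c2.
rewrite /inner /cintegral; apply/eqP; rewrite eq_complex /=.
rewrite -!RintegralZl// -RintegralB; [|by []|exact: iZ..].
rewrite -RintegralD; [|by []|exact: iZ..].
apply/andP; split; apply/eqP; apply: eq_Rintegral => p _.
  by case: (f p) (v p) => ? ? [? ?] /=; ring.
by case: (f p) (v p) => ? ? [? ?] /=; ring.
Qed.

(** An operator is an arbitrary relation, so even homogeneity has to be deduced: the condition that
    defines the adjoint is stable under multiplication by scalars. *)
Lemma selfadjointZ (S : operator R) c v g : selfadjoint S -> S v g ->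
  S (fun p => c * v p) (fun p => c * g p).
Proof.
move=> sS Svg; have [Lv Lg vg] := (sS v g).1 Svg.
apply/sS; split; [exact: L2Z|exact: L2Z|] => u f Suf.
have [Lu Lf _] := (sS u f).1 Suf.
by rewrite !innerZr// (vg _ _ Suf).
Qed.
End Hilbert.

(** * Solutions exponential in time *)

Section Decay.
Variable R : realType.
Implicit Types (u g W : field_on_plane R) (z k : R[i]).

Lemma sqrt_sqmod_le_l1 z : Num.sqrt (sqmod z) <= l1 z.
Proof.
rewrite -[leRHS]ger0_norm ?l1_ge0// -sqrtr_sqr ler_wsqrtr//.
rewrite /sqmod /l1 -(real_normK (num_real (complex.Re z))) -(real_normK (num_real (complex.Im z))).
have := normr_ge0 (complex.Re z); have := normr_ge0 (complex.Im z); nra.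
Qed.

Lemma sqrt_sqmod_cexp z : Num.sqrt (sqmod (cexp z)) = expR (complex.Re z).
Proof.
have -> : sqmod (cexp z) = expR (complex.Re z) ^+ 2.
  rewrite /sqmod /cexp /=; have := cos2Dsin2 (complex.Im z).
  by rewrite !exprMn -mulrDr => ->; rewrite mulr1.
by rewrite sqrtr_sqr ger0_norm ?expR_ge0.
Qed.

(** Keeping the prefactor makes the family closed under differentiation: the derivative of
    [expc k z] is [expc (k * z) z]. All components of a mode depend on time in this way. *)
Definition expc k z (t : R) : R[i] := k * cexp (z * t%:C%C).

(** [N] stands for the norm of the spatial profile. Multiplying by it instead of dividing the
    tolerance avoids a separate case for the zero profile. *)
Lemma expc_near k z (t N e : R) : 0 <= N -> 0 < e ->
  \forall s \near nbhs t,
    l1 (expc k z s - expc k z t) * N <= e /\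
    l1 (expc k z s - expc k z t - Complex (s - t) 0 * expc (k * z) z t) * N
      <= e * `|s - t|.
Proof.
move=> N0 e0.
pose L := l1 z; pose K := l1 k * l1 (cexp (z * t%:C%C)).
have L0 : 0 <= L by exact: l1_ge0.
have K0 : 0 <= K by rewrite mulr_ge0// l1_ge0.
(* The neighbourhood has radius min(1, e) / Q. The term 2 L brings z (s - t) into the range of the
   quadratic estimate, the term in L^2 controls the remainder of the derivative, and 5 K L N
   controls continuity, since |exp w - 1| <= |w| + 8 |w|^2 <= 5 |w| for |w| <= 1/2. *)
pose Q := 1 + 2 * L + (8 * K * L ^+ 2 + 5 * K * L) * N.
have Q1 : 0 <= (8 * K * L ^+ 2) * N by rewrite !mulr_ge0 ?sqr_ge0 ?l1_ge0.
have Q2 : 0 <= (5 * K * L) * N by rewrite !mulr_ge0 ?l1_ge0.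
have Q0 : 0 < Q by rewrite /Q; lra.
apply/nbhs_ballP; exists (Num.min 1 e / Q) => /=.
  by rewrite divr_gt0// lt_min ltr01.
move=> s; rewrite /ball /= distrC ltr_pdivlMr// lt_min => /andP[].
set h := `|s - t| => hQ1 hQe.
have h0 : 0 <= h by exact: normr_ge0.
have hL : l1 (z * (s - t)%:C%C) <= L * h.
  by apply: (le_trans (l1M _ _)); rewrite l1_real.
have hL2 : l1 (z * (s - t)%:C%C) <= 2^-1.
  apply: (le_trans hL).
  have : h * (2 * L) <= h * Q by rewrite ler_wpM2l// /Q; lra.
  by lra.
have quad := cexp_quad hL2.
have quad' : l1 (cexp (z * (s - t)%:C%C) - 1 - z * (s - t)%:C%C) <= 8 * (L * h) ^+ 2.
  apply: (le_trans quad); rewrite ler_wpM2l// lerXn2r ?nnegrE ?l1_ge0//.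
  by rewrite mulr_ge0.
have es : expc k z s = k * cexp (z * t%:C%C) * cexp (z * (s - t)%:C%C).
  rewrite /expc -mulrA -cexpD; congr (_ * cexp _).
  by rewrite rmorphB /=; ring.
have Kl : l1 (k * cexp (z * t%:C%C)) <= K by exact: l1M.
split.
- have -> : expc k z s - expc k z t =
    (k * cexp (z * t%:C%C)) * ((cexp (z * (s - t)%:C%C) - 1 - z * (s - t)%:C%C) + z * (s - t)%:C%C).
    by rewrite es /expc; ring.
  have h5 : l1 ((cexp (z * (s - t)%:C%C) - 1 - z * (s - t)%:C%C) + z * (s - t)%:C%C) <= 5 * (L * h).
    apply: (le_trans (l1D _ _)); move: hL hL2 quad (l1_ge0 (z * (s - t)%:C%C)).
    by set x := l1 (z * _) => a1 a2 a3 a4; nra.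
  apply: (@le_trans _ _ (K * (5 * (L * h)) * N)).
    rewrite ler_wpM2r// (le_trans (l1M _ _))//.
    by rewrite ler_pM ?l1_ge0.
  have : (5 * K * L * N) * h <= Q * h by rewrite ler_wpM2r// /Q; lra.
  by lra.
- have -> : expc k z s - expc k z t - Complex (s - t) 0 * expc (k * z) z t =
    (k * cexp (z * t%:C%C)) * (cexp (z * (s - t)%:C%C) - 1 - z * (s - t)%:C%C).
    by rewrite es /expc -[Complex (s - t) 0]/((s - t)%:C%C); ring.
  apply: (@le_trans _ _ (K * (8 * (L * h) ^+ 2) * N)).
    rewrite ler_wpM2r// (le_trans (l1M _ _))//.
    by rewrite ler_pM ?l1_ge0.
  have -> : K * (8 * (L * h) ^+ 2) * N = (8 * K * L ^+ 2 * N * h) * h by ring.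
  rewrite ler_wpM2r//.
  have : (8 * K * L ^+ 2 * N) * h <= Q * h by rewrite ler_wpM2r// /Q; lra.
  by lra.
Qed.

Lemma L2_derivative_expc k z W : L2 W ->
  L2_derivative (fun t p => expc k z t * W p) (fun t p => expc (k * z) z t * W p).
Proof.
move=> LW t t0 e e0; have N0 : 0 <= L2norm W by exact: sqrtr_ge0.
apply: filterS (expc_near k z t N0 e0) => s [_ h] _.
have -> : (fun p => expc k z s * W p - expc k z t * W p -
    Complex (s - t) 0 * (expc (k * z) z t * W p)) =
  (fun p => (expc k z s - expc k z t - Complex (s - t) 0 * expc (k * z) z t) * W p).
  by apply/funext => p; ring.
by rewrite L2normZ//; apply: le_trans h; rewrite ler_wpM2r// sqrt_sqmod_le_l1.
Qed.

Lemma L2_continuous_expc k z W : L2 W -> L2_continuous (fun t p => expc k z t * W p).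
Proof.
move=> LW t t0 e e0; have N0 : 0 <= L2norm W by exact: sqrtr_ge0.
apply: filterS (expc_near k z t N0 e0) => s [h _] _.
have -> : (fun p => expc k z s * W p - expc k z t * W p) =
  (fun p => (expc k z s - expc k z t) * W p).
  by apply/funext => p; ring.
by rewrite L2normZ//; apply: le_trans h; rewrite ler_wpM2r// sqrt_sqmod_le_l1.
Qed.

(** Every component is a scalar exponential times a fixed field. The eigenvalue equation, assumed at
    every point, identifies - a - b v at time t with z^2 exp(z t) u, the time derivative of v. *)
Lemma eigenmode_solution (A S : operator R) (b : R * R -> R) z u g a :
  selfadjoint S -> (forall u f, A u f <-> exists2 g, S u g & S g f) ->
  S u g -> S g a -> (forall p, - a p - Complex (b p) 0 * (z * u p) = z ^+ 2 * u p) ->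
  solution A S b u (fun p => z * u p)
    (fun t p => expc 1 z t * u p) (fun t p => expc z z t * u p).
Proof.
move=> sS hA Sug Sga hz.
have [Lu Lg _] := (sS _ _).1 Sug.
have e0 k : expc k z 0 = k by rewrite /expc rmorph0 mulr0 cexp0 mulr1.
exists (fun t p => expc 1 z t * a p), (fun t p => expc 1 z t * g p),
  (fun t p => expc z z t * g p) => w.
have wE : w = (fun t p => expc (z * z) z t * u p).
  apply/funext => t; apply/funext => p; rewrite /w.
  transitivity (expc 1 z t * (- a p - Complex (b p) 0 * (z * u p))).
    by rewrite /expc; ring.
  by rewrite hz /expc; ring.
split.
- move=> t _; split; first apply/hA.
  + by exists (fun p => expc 1 z t * g p); exact: selfadjointZ.
  + exact: selfadjointZ.
  + exact: selfadjointZ.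
- rewrite wE; split; last exact: L2_derivative_expc.
    by have := @L2_derivative_expc 1 z u Lu; rewrite mul1r.
  by have := @L2_derivative_expc 1 z g Lg; rewrite mul1r.
- by rewrite wE; split; exact: L2_continuous_expc.
- have aer (x y : field_on_plane R) : x = y -> ae_eq_cell x y.
    by move=> ->; apply: aeW.
  by split; apply: aer; apply/funext => p; rewrite e0 ?mul1r.
Qed.
End Decay.

(** * From slowly decaying modes to instability *)

Section Instability.
Variable R : realType.

Lemma sqmod_gt0 (z : R[i]) : z != 0 -> 0 < sqmod z.
Proof.
move=> z0; rewrite lt_neqAle sqmod_ge0 andbT eq_sym; apply: contra z0.
rewrite paddr_eq0 ?sqr_ge0// !sqrf_eq0 => /andP[/eqP hr /eqP hi].
by rewrite eq_complex hr hi !eqxx.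
Qed.

(* An eigenmode decays like [expR (t * Re z)], whereas stability at rate [f]
   bounds the energy at time [t] by [C * f t * |z|] times the initial one. *)
Lemma eigenmode_rate (A S : operator R) (b : R * R -> R) (f : R -> R) z u a
    (C t : R) :
  is_sqrt A S -> A u a -> 0 < L2norm u -> z != 0 ->
  (forall p, - a p - Complex (b p) 0 * (z * u p) = z ^+ 2 * u p) ->
  0 <= C * f t ->
  (forall u0 u1 a0 r1 : field_on_plane R, A u0 a0 -> S u1 r1 ->
   forall u v : R -> field_on_plane R, solution A S b u0 u1 u v ->
   forall (t : R) (q : field_on_plane R), 0 < t -> S (u t) q ->
    Num.sqrt (energy q (v t)) <= C * f t * generator_norm b a0 u1 r1) ->
  0 < t -> Num.sqrt 2^-1 * expR (complex.Re z * t) <= C * f t * l1 z.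
Proof.
move=> [sS _ hA] Aua u0 z0 hz Cf0 stab t0.
have sqE (c : R[i]) : Num.sqrt (sqmod c) ^+ 2 = sqmod c by rewrite sqr_sqrtr ?sqmod_ge0.
have [g Sug Sga] := (hA _ _).1 Aua.
have [Lu Lg _] := (sS _ _).1 Sug.
have sol := eigenmode_solution sS hA Sug Sga hz.
have := stab _ _ _ _ Aua (selfadjointZ z sS Sug) _ _ sol t _ t0 (selfadjointZ _ sS Sug).
(* As r1 = z g and - a - b z u = z^2 u, applying the generator multiplies the norm of the data by
   |z|. The remaining square root also occurs in the energy at time t, and is positive, so it
   cancels. *)
have -> : generator_norm b a (fun p => z * u p) (fun p => z * g p) =
    Num.sqrt (sqmod z) * Num.sqrt (L2norm g ^+ 2 + sqmod z * L2norm u ^+ 2).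
  rewrite /generator_norm -sqrtrM ?sqmod_ge0//; congr Num.sqrt.
  have -> : (fun p => - a p - Complex (b p) 0 * (z * u p)) = (fun p => z ^+ 2 * u p).
    by apply/funext => p; rewrite hz.
  by rewrite !L2normZ// !exprMn !sqE expr2 sqmodM; ring.
have -> : Num.sqrt (energy (fun p => expc 1 z t * g p) (fun p => expc z z t * u p)) =
    Num.sqrt 2^-1 * expR (complex.Re z * t) *
    Num.sqrt (L2norm g ^+ 2 + sqmod z * L2norm u ^+ 2).
  have s1 : sqmod (expc 1 z t) = expR (complex.Re z * t) ^+ 2.
    have e : expR (complex.Re z * t) = Num.sqrt (sqmod (expc 1 z t)).
      rewrite /expc mul1r sqrt_sqmod_cexp; congr expR.
      by case: z {z0 hz sol} => x y /=; ring.
    by rewrite e sqr_sqrtr ?sqmod_ge0.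
  have s2 : sqmod (expc z z t) = sqmod z * expR (complex.Re z * t) ^+ 2.
    by rewrite -s1 -sqmodM /expc mul1r.
  rewrite -[expR _]ger0_norm ?expR_ge0// -sqrtr_sqr -!sqrtrM ?mulr_ge0 ?sqr_ge0//.
  rewrite /energy !L2normZ// !exprMn !sqE s1 s2; congr Num.sqrt; ring.
rewrite [leRHS]mulrA ler_pM2r; last first.
  by rewrite sqrtr_gt0 ltr_wpDl ?sqr_ge0// mulr_gt0 ?sqmod_gt0// exprn_gt0.
by move=> /le_trans; apply; rewrite ler_wpM2l// sqrt_sqmod_le_l1.
Qed.

Lemma not_stable_of_eigenmodes (A S : operator R) (b : R * R -> R) (eps K : R) :
  0 < eps -> is_sqrt A S ->
  (forall N : R, exists nu z u a, [/\ [/\ N <= nu, 1 <= nu & A u a],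
     (forall p, - a p - Complex (b p) 0 * (z * u p) = z ^+ 2 * u p),
     0 < L2norm u, z != 0 &
     `|complex.Re z| * (nu * Num.sqrt nu) <= K /\ l1 z <= 3 * nu]) ->
  ~ stable_at_rate A S b (fun t => (t `^ (2 / 3 + eps))^-1).
Proof.
move=> eps0 sq modes [C C0 stab].
pose m := Num.sqrt 2^-1 * expR (- K).
have m0 : 0 < m by rewrite mulr_gt0 ?expR_gt0// sqrtr_gt0 invr_gt0.
have [nu [z [u [a [[Nnu nu1 Aua] hz u0 z0 [zK z3]]]]]] :=
  (* Since t >= nu, this threshold gives t^eps >= 3 C / m + 1, whereas stability would give m <= 3 C
     / t^eps. *)
  modes (1 + (3 * C / m + 1) `^ eps^-1).
have nu0 : 0 < nu by exact: lt_le_trans nu1.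
have s1 : 1 <= Num.sqrt nu by rewrite -[leLHS]sqrtr1 ler_wsqrtr.
pose t := nu * Num.sqrt nu.
have nut : nu <= t by rewrite ler_peMr// ltW.
have t0 : 0 < t by exact: lt_le_trans nut.
have ft0 : 0 <= C * (t `^ (2 / 3 + eps))^-1 by rewrite mulr_ge0 ?(ltW C0)// invr_ge0 powR_ge0.
have := @eigenmode_rate A S b (fun t => (t `^ (2 / 3 + eps))^-1) z u a C t sq Aua u0 z0 hz
  ft0 stab t0.
have e1 : m <= Num.sqrt 2^-1 * expR (complex.Re z * t).
  rewrite ler_wpM2l ?sqrtr_ge0// ler_expR.
  have := ler_norm (- (complex.Re z * t)); rewrite normrN normrM (gtr0_norm t0).
  by move=> h; rewrite lerNl (le_trans h).
(* With t = nu^(3/2), the factor t^(2/3) is exactly nu and cancels the growth of |z| <= 3 nu; only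
   t^eps is left to contradict stability. *)
have tE : t `^ (2 / 3 + eps) = nu * t `^ eps.
  rewrite powRD ?(gt_eqF t0) ?implybT//; congr (_ * _).
  have -> : t = nu `^ (3 / 2).
    rewrite /t -powR12_sqrt ?(ltW nu0)// -{1}(powRr1 (ltW nu0)) -powRD.
      by congr (_ `^ _); field.
    by rewrite (gt_eqF nu0) implybT.
  by rewrite -powRrM (_ : 3 / 2 * (2 / 3) = 1) ?powRr1 ?(ltW nu0)//; field.
have te0 : 0 < t `^ eps by exact: powR_gt0.
have e2 : C * (t `^ (2 / 3 + eps))^-1 * l1 z <= 3 * C / t `^ eps.
  apply: (le_trans (ler_wpM2l ft0 z3)); rewrite tE le_eqVlt; apply/orP; left.
  by apply/eqP; field; rewrite !gt_eqF.
move=> /(le_trans e1)/le_trans/(_ e2); rewrite ler_pdivlMr// mulrC -ler_pdivlMr//.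
apply/negP; rewrite -ltNge.
apply: (@lt_le_trans _ _ (3 * C / m + 1)); first by rewrite ltrDl.
have p0 : 0 <= 3 * C / m + 1 by rewrite addr_ge0// divr_ge0 ?ltW// mulr_gt0.
have -> : 3 * C / m + 1 = ((3 * C / m + 1) `^ eps^-1) `^ eps.
  by rewrite -powRrM mulVf ?gt_eqF// powRr1.
apply: ge0_ler_powR; rewrite ?nnegrE ?powR_ge0 ?(ltW eps0) ?(ltW t0)//.
by apply: le_trans nut; apply: le_trans Nnu; rewrite lerDr.
Qed.
End Instability.

(** * The eigenmodes *)

Section ComplexDerivative.
Variable R : realType.
Implicit Types (F G : R -> R[i]) (a al be : R[i]).

Definition cderive F F' := forall x : R,
  is_derive x 1 (fun x => complex.Re (F x)) (complex.Re (F' x)) /\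
  is_derive x 1 (fun x => complex.Im (F x)) (complex.Im (F' x)).

Lemma cderive_exp a al :
  cderive (fun x => al * cexp (a * x%:C%C)) (fun x => a * al * cexp (a * x%:C%C)).
Proof.
case: a al => [a b] [c d] x.
have ab (y : R) : cexp (Complex a b * y%:C%C) =
    Complex (expR (a * y) * cos (b * y)) (expR (a * y) * sin (b * y)).
  have -> : Complex a b * y%:C%C = Complex (a * y) (b * y) by
    apply/eqP; rewrite eq_complex /=; apply/andP; split; apply/eqP; ring.
  by [].
have dl (k : R) : is_derive x 1 (fun y : R => k * y) k.
  by apply: is_derive_eq; rewrite /GRing.scale /=; ring.
have dE : is_derive x 1 (fun y => expR (a * y)) (expR (a * x) * a).
  exact: (is_derive1_comp (is_derive_expR _) (dl a)).
have dC : is_derive x 1 (fun y => cos (b * y)) (- sin (b * x) * b).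
  exact: (is_derive1_comp (is_derive_cos _) (dl b)).
have dS : is_derive x 1 (fun y => sin (b * y)) (cos (b * x) * b).
  exact: (is_derive1_comp (is_derive_sin _) (dl b)).
rewrite ab /=; split.
- have -> : (fun y => complex.Re (Complex c d * cexp (Complex a b * y%:C%C))) =
      (fun y => c * (expR (a * y) * cos (b * y)) - d * (expR (a * y) * sin (b * y))).
    by apply/funext => y; rewrite ab.
  by apply: is_derive_eq; rewrite /GRing.scale /=; ring.
- have -> : (fun y => complex.Im (Complex c d * cexp (Complex a b * y%:C%C))) =
      (fun y => c * (expR (a * y) * sin (b * y)) + d * (expR (a * y) * cos (b * y))).
    by apply/funext => y; rewrite ab.
  by apply: is_derive_eq; rewrite /GRing.scale /=; ring.
Qed.

Lemma cderiveD F F' G G' : cderive F F' -> cderive G G' ->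
  cderive (fun x => F x + G x) (fun x => F' x + G' x).
Proof.
move=> dF dG x; have [f1 f2] := dF x; have [g1 g2] := dG x; split.
- have -> : (fun x => complex.Re (F x + G x)) = (fun x => complex.Re (F x) + complex.Re (G x)).
    by apply/funext => y; case: (F y) (G y) => ? ? [].
  by apply: is_derive_eq; case: (F' x) (G' x) => ? ? [].
- have -> : (fun x => complex.Im (F x + G x)) = (fun x => complex.Im (F x) + complex.Im (G x)).
    by apply/funext => y; case: (F y) (G y) => ? ? [].
  by apply: is_derive_eq; case: (F' x) (G' x) => ? ? [].
Qed.

Lemma cderive_glue F F' G G' (c : R) : cderive F F' -> cderive G G' ->
  F c = G c -> F' c = G' c -> cderive (glue c F G) (glue c F' G').
Proof.
move=> dF dG FG FG' x.
have Re_glue (H K : R -> R[i]) y : complex.Re (glue c H K y) =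
    glue c (fun x => complex.Re (H x)) (fun x => complex.Re (K x)) y.
  by rewrite /glue; case: ifP.
have Im_glue (H K : R -> R[i]) y : complex.Im (glue c H K y) =
    glue c (fun x => complex.Im (H x)) (fun x => complex.Im (K x)) y.
  by rewrite /glue; case: ifP.
split.
- rewrite Re_glue (_ : (fun y => complex.Re (glue c F G y)) =
    glue c (fun x => complex.Re (F x)) (fun x => complex.Re (G x))); last exact/funext.
  by apply: is_derive_glue => [y|y||]; [have [] := dF y|have [] := dG y|rewrite FG|rewrite FG'].
- rewrite Im_glue (_ : (fun y => complex.Im (glue c F G y)) =
    glue c (fun x => complex.Im (F x)) (fun x => complex.Im (G x))); last exact/funext.
  by apply: is_derive_glue => [y|y||]; [have [] := dF y|have [] := dG y|rewrite FG|rewrite FG'].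
Qed.

Definition ccont F := continuous (fun x => complex.Re (F x)) /\
  continuous (fun x => complex.Im (F x)).

Lemma cderive_ccont F F' : cderive F F' -> ccont F.
Proof.
move=> dF; split.
  by apply: (@is_derive_continuous _ _ (fun x => complex.Re (F' x))) => x; have [] := dF x.
by apply: (@is_derive_continuous _ _ (fun x => complex.Im (F' x))) => x; have [] := dF x.
Qed.

Lemma cweak_derive_smooth (a b : R) F F' G G' : a < b ->
  ccont F -> measurable_fun setT (fun x => complex.Re (F' x)) ->
  measurable_fun setT (fun x => complex.Im (F' x)) ->
  ccont G' -> cderive G G' ->
  (forall x, a <= x <= b -> F x = G x) -> (forall x, a < x < b -> F' x = G' x) ->
  cweak_derive a b F F'.
Proof.
move=> ab [cF1 cF2] m1 m2 [cG1 cG2] dG FG FG'; split.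
- apply: (@weak_derive_smooth _ _ _ _ _ (fun x => complex.Re (G x)) (fun x => complex.Re (G' x))) => //.
  + exact: continuous_measurable_fun.
  + by move=> x; have [] := dG x.
  + by move=> x xab; rewrite FG.
  + by move=> x xab; rewrite FG'.
- apply: (@weak_derive_smooth _ _ _ _ _ (fun x => complex.Im (G x)) (fun x => complex.Im (G' x))) => //.
  + exact: continuous_measurable_fun.
  + by move=> x; have [] := dG x.
  + by move=> x xab; rewrite FG.
  + by move=> x xab; rewrite FG'.
Qed.

Lemma cweak_derive_cat (a b c : R) F F' : a < c -> c < b ->
  cweak_derive a c F F' -> cweak_derive c b F F' -> cweak_derive a b F F'.
Proof.
by move=> ac cb [r1 i1] [r2 i2]; split; exact: weak_derive_cat ac cb _ _.
Qed.
End ComplexDerivative.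

(** * The profile in the x variable *)

Section TransverseMode.
Variable R : realType.

Definition exp_pair (a al be : R[i]) (x : R) : R[i] :=
  al * cexp (a * x%:C%C) + be * cexp (- (a * x%:C%C)).

Lemma cderive_exp_pair a al be :
  cderive (exp_pair a al be) (exp_pair a (a * al) (- (a * be))).
Proof.
have -> : exp_pair a al be =
    (fun x => al * cexp (a * x%:C%C) + be * cexp (- a * x%:C%C)).
  by apply/funext => x; rewrite /exp_pair mulNr.
have -> : exp_pair a (a * al) (- (a * be)) =
    (fun x => a * al * cexp (a * x%:C%C) + - a * be * cexp (- a * x%:C%C)).
  by apply/funext => x; rewrite /exp_pair !mulNr.
by apply: cderiveD; exact: cderive_exp.
Qed.

Lemma exp_pair2 a al be x :
  exp_pair a (a * (a * al)) (- (a * - (a * be))) x = a ^+ 2 * exp_pair a al be x.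
Proof. by rewrite /exp_pair; ring. Qed.

(** The inner exponentials get the coefficient P = e + tau e' and the outer ones D = c + c': both
    pieces then equal D P at |x| = sigma without any division, and the matching of derivatives is
    exactly the third equation. Even if D vanished, X would not be zero, since X 0 = 2 P. [X2] is
    defined by the eigenvalue equation, which therefore holds at every point, interfaces
    included. *)
Lemma transverse_mode (sigma B lam : R) (z k kap tau : R[i]) :
  0 < sigma -> sigma < 2^-1 ->
  let ell := 2^-1 - sigma in
  let c := cexp ('i%C * k * sigma%:C%C) in
  let c' := cexp (- ('i%C * k * sigma%:C%C)) in
  let e := cexp (ell%:C%C * kap) in
  let e' := cexp (- (ell%:C%C * kap)) in
  z ^+ 2 = - (lam%:C%C + k ^+ 2) ->
  kap ^+ 2 = B%:C%C * z - k ^+ 2 ->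
  kap * (c + c') * (e - tau * e') = - ('i%C * k) * (c - c') * (e + tau * e') ->
  e + tau * e' != 0 ->
  exists X X1 : R -> R[i],
  let X2 := fun x => (z ^+ 2 + lam%:C%C +
    Complex (damping sigma B (x, 0)) 0 * z) * X x in
  [/\ cderive X X1 /\ ccont X1, cweak_derive (- 2^-1) 2^-1 X X1,
      cweak_derive (- 2^-1) 2^-1 X1 X2, X 0 != 0 &
      exists D : R[i], [/\ X (- 2^-1) = D * (1 + tau), X 2^-1 = D * (1 + tau),
        X1 (- 2^-1) = D * kap * (1 - tau) & X1 2^-1 = D * kap * (tau - 1)]].
Proof.
move=> s0 s2 ell c c' e e' hz hk match_ P0.
have ii : 'i%C * 'i%C = -1 :> R[i] by rewrite -expr2 sqr_i.
pose D := c + c'; pose P := e + tau * e'.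
pose h := cexp (kap * (2^-1)%:C%C); pose h' := cexp (- (kap * (2^-1)%:C%C)).
have hh' : h * h' = 1 by exact: cexpNK.
(* Up to D, the outer pieces are exp(kap r) + tau exp(- kap r), where r is the distance to the
   nearest end x = -1/2 or x = 1/2; this displays the boundary condition encoded by [tau]. *)
pose F1 := exp_pair kap (D * h) (D * tau * h').
pose F2 := exp_pair ('i%C * k) P P.
pose F3 := exp_pair kap (D * tau * h') (D * h).
pose F1' := exp_pair kap (kap * (D * h)) (- (kap * (D * tau * h'))).
pose F2' := exp_pair ('i%C * k) ('i%C * k * P) (- ('i%C * k * P)).
pose F3' := exp_pair kap (kap * (D * tau * h')) (- (kap * (D * h))).
have dF1 : cderive F1 F1' by exact: cderive_exp_pair.
have dF2 : cderive F2 F2' by exact: cderive_exp_pair.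
have dF3 : cderive F3 F3' by exact: cderive_exp_pair.
have ex1 : h * cexp (- (kap * sigma%:C%C)) = e.
  rewrite /h /e -cexpD; congr cexp; rewrite /ell rmorphB /=; ring.
have ex2 : h' * cexp (kap * sigma%:C%C) = e'.
  rewrite /h' /e' -cexpD; congr cexp; rewrite /ell rmorphB /=; ring.
have m3 : F2 sigma = F3 sigma.
  rewrite /F2 /F3 /exp_pair -/c -/c'.
  transitivity (D * (tau * (h' * cexp (kap * sigma%:C%C)) + h * cexp (- (kap * sigma%:C%C)))).
    by rewrite ex1 ex2 /P /D; ring.
  ring.
have m3' : F2' sigma = F3' sigma.
  rewrite /F2' /F3' /exp_pair -/c -/c'.
  transitivity (- (kap * D * (h * cexp (- (kap * sigma%:C%C)) - tau * (h' * cexp (kap * sigma%:C%C))))); last by ring.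
  by rewrite ex1 ex2 /D match_ /P; ring.
have N x : (- x)%:C%C = - x%:C%C :> R[i] by rewrite rmorphN.
have m1 : F1 (- sigma) = F2 (- sigma).
  rewrite /F1 /F2 /exp_pair N !mulrN !opprK -/c -/c'.
  transitivity (D * (tau * (h' * cexp (kap * sigma%:C%C)) + h * cexp (- (kap * sigma%:C%C)))).
    by ring.
  by rewrite ex1 ex2 /P /D; ring.
have m1' : F1' (- sigma) = F2' (- sigma).
  rewrite /F1' /F2' /exp_pair N !mulrN !opprK -/c -/c'.
  transitivity (kap * D * (h * cexp (- (kap * sigma%:C%C)) - tau * (h' * cexp (kap * sigma%:C%C)))); first by ring.
  by rewrite ex1 ex2 /D match_ /P; ring.
have ss : - sigma < sigma by lra.
have glue_l T (f g : R -> T) : glue sigma f g (- sigma) = f (- sigma) by rewrite /glue ss.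
have glue_r T (f g : R -> T) t : glue t f g t = g t by rewrite /glue ltxx.
pose X := glue (- sigma) F1 (glue sigma F2 F3).
pose X1 := glue (- sigma) F1' (glue sigma F2' F3').
have dX : cderive X X1.
  apply: cderive_glue => //; last by rewrite glue_l.
    exact: cderive_glue.
  by rewrite glue_l.
have cF a al be : ccont (exp_pair a al be).
  exact: (cderive_ccont (cderive_exp_pair _ _ _)).
have cglue G H (t : R) : ccont G -> ccont H -> G t = H t -> ccont (glue t G H).
  move=> [G1 G2] [H1 H2] GH; split.
    have -> : (fun x => complex.Re (glue t G H x)) =
        glue t (fun x => complex.Re (G x)) (fun x => complex.Re (H x)).
      by apply/funext => x; rewrite /glue; case: ifP.
    by apply: continuous_glue => //; rewrite GH.
  have -> : (fun x => complex.Im (glue t G H x)) =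
      glue t (fun x => complex.Im (G x)) (fun x => complex.Im (H x)).
    by apply/funext => x; rewrite /glue; case: ifP.
  by apply: continuous_glue => //; rewrite GH.
have cX1 : ccont X1.
  by apply: (cglue) => [||]; [exact: cF|apply: cglue => //; exact: cF|rewrite glue_l].
have cX := cderive_ccont dX.
exists X, X1 => X2.
have E1 x : x <= - sigma -> X x = F1 x /\ X1 x = F1' x.
  rewrite le_eqVlt /X /X1 => /predU1P[->|xs].
    by rewrite !glue_r !glue_l m1 m1'.
  by rewrite /glue xs.
have E2 x : - sigma <= x <= sigma -> X x = F2 x /\ X1 x = F2' x.
  move=> /andP[x1 x2]; rewrite /X /X1 /glue ltNge x1 /=.
  by move: x2; rewrite le_eqVlt => /predU1P[->|->//]; rewrite ltxx -m3 -m3'.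
have E3 x : sigma <= x -> X x = F3 x /\ X1 x = F3' x.
  move=> x1; have x2 : - sigma <= x by apply: le_trans x1; exact: ltW.
  by rewrite /X /X1 /glue ltNge x2 /= ltNge x1.
have d1 x : x < - sigma -> damping sigma B (x, 0) = B.
  move=> xs; rewrite /damping /= ifF//; apply/negbTE; rewrite -ltNge ltr0_norm; lra.
have d2 x : - sigma < x < sigma -> damping sigma B (x, 0) = 0.
  by move=> /andP[x1 x2]; rewrite /damping /= ifT// ler_norml !ltW.
have d3 x : sigma < x -> damping sigma B (x, 0) = B.
  move=> xs; rewrite /damping /= ifF//; apply/negbTE; rewrite -ltNge gtr0_norm//; lra.
(* The coefficient in [X2] is (i k)^2 in the strip and kap^2 outside it, so [X2] is the second
   derivative of each exponential piece. *)
have zk : z ^+ 2 + lam%:C%C = ('i%C * k) ^+ 2.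
  by transitivity ('i%C * 'i%C * k ^+ 2); [rewrite hz ii|]; ring.
have zkap : z ^+ 2 + lam%:C%C + Complex B 0 * z = kap ^+ 2.
  by rewrite hk hz -[Complex B 0]/(B%:C%C); ring.
have mdamp : measurable_fun setT (fun x : R => damping sigma B (x, 0)).
  rewrite /damping /=; apply: measurable_fun_ifT => //.
  by apply: measurable_fun_ler => //; exact: measurableT_comp.
have [cXr cXi] := cX.
have mX (r : R -> R) : measurable_fun setT r -> measurable_fun setT (fun x : R => r x * complex.Re (X x)) /\
    measurable_fun setT (fun x => r x * complex.Im (X x)).
  by move=> mr; split; apply: measurable_funM => //; exact: continuous_measurable_fun.
pose r1 x : R := complex.Re (z ^+ 2 + lam%:C%C) + damping sigma B (x, 0) * complex.Re z.
pose r2 x : R := complex.Im (z ^+ 2 + lam%:C%C) + damping sigma B (x, 0) * complex.Im z.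
have mr1 : measurable_fun setT r1.
  by apply: measurable_funD => //; apply: measurable_funM.
have mr2 : measurable_fun setT r2.
  by apply: measurable_funD => //; apply: measurable_funM.
have mX2r : measurable_fun setT (fun x => complex.Re (X2 x)).
  have -> : (fun x => complex.Re (X2 x)) =
      (fun x => r1 x * complex.Re (X x) - r2 x * complex.Im (X x)).
    apply/funext => x; rewrite /X2 /r1 /r2; move: (z ^+ 2 + _) (damping _ _ _) (X x).
    by case: (z) => z1 z2 [a1 a2] y [b1 b2] /=; ring.
  by apply: measurable_funB; [exact: (mX _ mr1).1|exact: (mX _ mr2).2].
have mX2i : measurable_fun setT (fun x => complex.Im (X2 x)).
  have -> : (fun x => complex.Im (X2 x)) =
      (fun x => r1 x * complex.Im (X x) + r2 x * complex.Re (X x)).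
    apply/funext => x; rewrite /X2 /r1 /r2; move: (z ^+ 2 + _) (damping _ _ _) (X x).
    by case: (z) => z1 z2 [a1 a2] y [b1 b2] /=; ring.
  by apply: measurable_funD; [exact: (mX _ mr1).2|exact: (mX _ mr2).1].
split.
- by [].
- apply: (cweak_derive_smooth _ cX _ _ cX1 dX) => //; first lra.
    by apply: continuous_measurable_fun; exact: cX1.1.
  by apply: continuous_measurable_fun; exact: cX1.2.
- have s3 : - 2^-1 < - sigma by lra.
  apply: (@cweak_derive_cat _ _ _ (- sigma)) => //; first lra.
    apply: (cweak_derive_smooth s3 cX1 mX2r mX2i (cF _ _ _) (cderive_exp_pair kap _ _)).
      by move=> x /andP[_ xs]; have [_ ->] := E1 _ xs.
    by move=> x /andP[_ xs]; rewrite exp_pair2 /X2 (E1 _ (ltW xs)).1 d1// zkap.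
  apply: (@cweak_derive_cat _ _ _ sigma) => //.
    apply: (cweak_derive_smooth ss cX1 mX2r mX2i (cF _ _ _) (cderive_exp_pair ('i%C * k) _ _)).
      by move=> x xs; have [_ ->] := E2 _ xs.
    move=> x xs; have xs' : - sigma <= x <= sigma by case/andP: xs => /ltW -> /ltW ->.
    by rewrite exp_pair2 /X2 (E2 _ xs').1 d2// (_ : Complex 0 0 = 0)// mul0r addr0 zk.
  apply: (cweak_derive_smooth s2 cX1 mX2r mX2i (cF _ _ _) (cderive_exp_pair kap _ _)).
    by move=> x /andP[xs _]; have [_ ->] := E3 _ xs.
  by move=> x /andP[xs _]; rewrite exp_pair2 /X2 (E3 _ (ltW xs)).1 d3// zkap.
- have s00 : - sigma <= 0 <= sigma by apply/andP; split; lra.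
  rewrite (E2 _ s00).1 /F2 /exp_pair rmorph0 mulr0 oppr0 cexp0.
  have -> : P * 1 + P * 1 = P * 2 by ring.
  by rewrite mulf_neq0// pnatr_eq0.
- exists D.
  have l2 : - 2^-1 <= - sigma by lra.
  have [X1l X1l'] := E1 _ l2; have [X1r X1r'] := E3 _ (ltW s2).
  rewrite X1l X1l' X1r X1r' /F1 /F1' /F3 /F3' /exp_pair N !mulrN !opprK -/h -/h'.
  split.
  + by transitivity (D * (1 + tau) * (h * h')); [ring|rewrite hh' mulr1].
  + by transitivity (D * (1 + tau) * (h * h')); [ring|rewrite hh' mulr1].
  + by transitivity (D * kap * (1 - tau) * (h * h')); [ring|rewrite hh' mulr1].
  + by transitivity (D * kap * (tau - 1) * (h * h')); [ring|rewrite hh' mulr1].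
Qed.
End TransverseMode.

(** * Modes in the domains of the three Laplacians *)

Section Modes.
Variable R : realType.
Implicit Types (X : R -> R[i]) (Y : R -> R).

Lemma weak_derive_C1 (a b : R) (f f' : R -> R) : a < b -> continuous f' ->
  (forall x : R, is_derive x 1 f (f' x)) -> weak_derive a b f f'.
Proof.
move=> ab cf' df; apply: (weak_derive_smooth ab) (cf') (df) _ _ => //.
  exact: continuous_measurable_fun (is_derive_continuous df).
exact: continuous_measurable_fun.
Qed.

Lemma weak_H2_tensor P X X1 X2 Y Y1 Y2 :
  cweak_derive (- 2^-1) 2^-1 X X1 -> cweak_derive (- 2^-1) 2^-1 X1 X2 ->
  weak_derive 0 1 Y Y1 -> weak_derive 0 1 Y1 Y2 ->
  compatible_x P X -> compatible_x P X1 -> compatible_y P Y -> compatible_y P Y1 ->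
  weak_H2 P (tensor X Y) (tensor X1 Y) (tensor X Y1)
    (tensor X2 Y) (tensor X1 Y1) (tensor X1 Y1) (tensor X Y2).
Proof. by move=> *; split; exact: weak_grad_tensor. Qed.

Lemma L2_laplacian_tensor X X1 X2 Y Y1 Y2 :
  cweak_derive (- 2^-1) 2^-1 X X1 -> cweak_derive (- 2^-1) 2^-1 X1 X2 ->
  weak_derive 0 1 Y Y1 -> weak_derive 0 1 Y1 Y2 ->
  L2 (fun p => - (tensor X2 Y p + tensor X Y2 p)).
Proof.
move=> cX cX1 [bY _ _] [_ bY2 _]; apply: cmbd_L2.
have [bX _] := cweak_derive_cmbd cX; have [_ bX2] := cweak_derive_cmbd cX1.
have [h1 h2] := cmbd_tensor bX2 bY; have [h3 h4] := cmbd_tensor bX bY2.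
by split; apply: mbdN; exact: mbdD.
Qed.

Lemma compact_test_eq0 (phi : R * R -> R) (p : R * R) : compact_test phi ->
  ~ open_cell R p -> phi p = 0.
Proof.
move=> cphi pN; apply: contrapT => /eqP phip.
by apply: pN; apply: cphi; exact: subset_closure.
Qed.

Lemma compatible_x_compact X : compatible_x (@compact_test R) X.
Proof.
move=> phi cphi y _; rewrite !(compact_test_eq0 cphi) ?mulr0//.
  by move=> [/= + _]; rewrite in_itv /= ltxx.
by move=> [/= + _]; rewrite in_itv /= ltxx andbF.
Qed.

Lemma compatible_y_compact Y : compatible_y (@compact_test R) Y.
Proof.
move=> phi cphi x _; rewrite !(compact_test_eq0 cphi) ?mulr0//.
  by move=> [/= _]; rewrite in_itv /= ltxx.
by move=> [/= _]; rewrite in_itv /= ltxx andbF.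
Qed.

Lemma compatible_x_torus X : X (- 2^-1) = X 2^-1 -> compatible_x (@torus_test R) X.
Proof.
move=> XE phi tphi y _; have [h _] := tphi (- 2^-1) y.
rewrite XE -h (_ : - 2^-1 + 1 = 2^-1 :> R)//; lra.
Qed.

Lemma compatible_y_torus Y : Y 0 = Y 1 -> compatible_y (@torus_test R) Y.
Proof. by move=> YE phi tphi x _; have [_ h] := tphi x 0; rewrite YE -h add0r. Qed.

Lemma tensorE X Y p : tensor X Y p = X p.1 * (Y p.2)%:C%C.
Proof. by rewrite /tensor; case: (X p.1) => a b; apply/eqP; rewrite eq_complex /= !mulr0 subr0 add0r !eqxx. Qed.

Lemma cos_sin_2pin n : cos (2 * pi * n%:R) = 1 :> R /\ sin (2 * pi * n%:R) = 0 :> R.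
Proof.
elim: n => [|n [IHc IHs]]; first by rewrite mulr0 cos0 sin0.
have -> : 2 * pi * n.+1%:R = 2 * pi * n%:R + (pi + pi) :> R by rewrite -natr1; ring.
have c2 : cos (pi + pi) = 1 :> R by rewrite cosD cospi sinpi; ring.
have s2 : sin (pi + pi) = 0 :> R by rewrite sinD cospi sinpi; ring.
by rewrite !(cosD (2 * pi * n%:R), sinD (2 * pi * n%:R)) IHc IHs c2 s2; split; ring.
Qed.

Lemma is_derive_cosM (nu y : R) :
  is_derive y 1 (fun y => cos (nu * y)) (- nu * sin (nu * y)).
Proof.
have dl : is_derive y 1 (fun y : R => nu * y) nu.
  by apply: is_derive_eq; rewrite /GRing.scale /=; ring.
by apply: is_derive_eq (is_derive1_comp (is_derive_cos _) dl) _; ring.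
Qed.

Lemma is_derive_sinM (nu y : R) :
  is_derive y 1 (fun y => sin (nu * y)) (nu * cos (nu * y)).
Proof.
have dl : is_derive y 1 (fun y : R => nu * y) nu.
  by apply: is_derive_eq; rewrite /GRing.scale /=; ring.
by apply: is_derive_eq (is_derive1_comp (is_derive_sin _) dl) _; ring.
Qed.

Lemma weak_derive_trig (nu : R) :
  [/\ weak_derive 0 1 (fun y => cos (nu * y)) (fun y => - nu * sin (nu * y)),
      weak_derive 0 1 (fun y => - nu * sin (nu * y)) (fun y => - nu ^+ 2 * cos (nu * y)),
      weak_derive 0 1 (fun y => sin (nu * y)) (fun y => nu * cos (nu * y)) &
      weak_derive 0 1 (fun y => nu * cos (nu * y)) (fun y => - nu ^+ 2 * sin (nu * y))].
Proof.
have cs : continuous (fun y => sin (nu * y)) := is_derive_continuous (is_derive_sinM nu).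
have cc : continuous (fun y => cos (nu * y)) := is_derive_continuous (is_derive_cosM nu).
have cM (c : R) (f : R -> R) : continuous f -> continuous (fun y => c * f y).
  by move=> cf y; apply: cvgM; [exact: cvg_cst|exact: cf].
split; apply: weak_derive_C1 => //; try exact: cM.
- exact: is_derive_cosM.
- move=> y; have h := is_derive_sinM nu y.
  by apply: is_derive_eq; rewrite /GRing.scale /=; ring.
- exact: is_derive_sinM.
- move=> y; have h := is_derive_cosM nu y.
  by apply: is_derive_eq; rewrite /GRing.scale /=; ring.
Qed.

(** The hypothesis isolates what depends on the boundary conditions: a factor Y of frequency nu that
    puts the product in the domain of A. The end values of X contain 1 + tau and those of X1 contain
    1 - tau or its opposite, so tau = 1 cancels X1 and tau = -1 cancels X there. *)
Lemma not_stable_of_transverse_modes (A S : operator R) (sigma B eps : R) (tau : R[i]) :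
  0 < sigma -> sigma < 2^-1 -> 0 < B -> 0 < eps ->
  (forall n X X1 X2 (D E : R[i]), cderive X X1 -> ccont X1 ->
    cweak_derive (- 2^-1) 2^-1 X X1 -> cweak_derive (- 2^-1) 2^-1 X1 X2 ->
    X (- 2^-1) = D * (1 + tau) -> X 2^-1 = D * (1 + tau) ->
    X1 (- 2^-1) = E * (1 - tau) -> X1 2^-1 = E * (tau - 1) ->
    let nu := 2 * pi * n.+1%:R in
    exists Y y0, [/\ continuous Y, 0 < y0 < 1, Y y0 != 0 &
      A (tensor X Y) (fun p => - (tensor X2 Y p +
                                  tensor X (fun y => - nu ^+ 2 * Y y) p))]) ->
  is_sqrt A S ->
  ~ stable_at_rate A S (damping sigma B) (fun t => (t `^ (2 / 3 + eps))^-1).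
Proof.
move=> s0 s2 B0 eps0 HA sq.
have l0 : 0 < 2^-1 - sigma by rewrite subr_gt0.
have [K HK] := damped_eigenvalue tau s0 l0 B0.
apply: (not_stable_of_eigenmodes (K := K) eps0 sq) => N.
(* Then nu = 2 pi (n + 1) >= n + 1 exceeds 1, N and K at the same time. *)
pose n := Num.bound (`|N| + `|K|).
have nNK : `|N| + `|K| < n%:R.
  by have := archi_boundP (addr_ge0 (normr_ge0 N) (normr_ge0 K)).
pose nu : R := 2 * pi * n.+1%:R.
have n1 : n%:R + 1 <= nu.
  rewrite /nu natr1 ler_peMl//.
  by have := pi_ge2 R; lra.
have Nn := ler_norm N; have Kn := ler_norm K.
have N0 := normr_ge0 N; have K0 := normr_ge0 K.
have nuK : K <= nu by clear -nNK n1 Nn Kn N0 K0; lra.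
have [z [k [kap]]] := HK nu nuK.
move=> /= [hz hk hm hP [z0 zK z3]].
have [X [X1 [[dX cX1] aX aX1 X0 [D [Xl Xr X1l X1r]]]]] :=
  transverse_mode s0 s2 hz hk hm hP.
have [Y [y0 [cY y01 Yy0 AY]]] := HA n X X1 _ D (D * kap) dX cX1 aX aX1 Xl Xr X1l X1r.
have [cXr cXi] := cderive_ccont dX.
exists nu, z, (tensor X Y); eexists; split; last by split.
- split; last exact: AY.
    by clear -nNK n1 Nn Kn N0 K0; lra.
  by clear -nNK n1 N0 K0; lra.
- move=> p; rewrite !tensorE -[damping sigma B (p.1, 0)]/(damping sigma B p).
  have NM (x y : R) : (- x * y)%:C%C = - x%:C%C * y%:C%C by rewrite -rmorphN -rmorphM.
  rewrite /= NM.
  move: (Complex _ 0) (X _) (Y _)%:C%C (_ ^+ 2)%:C%C => b x y w; ring.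
- exact: L2norm_tensor_gt0 y01 Yy0.
- by [].
Qed.
End Modes.

Lemma tensor_dirichlet (R : realType) (X X1 X2 : R -> R[i]) (Y Y1 Y2 : R -> R) :
  cderive X X1 -> ccont X1 ->
  cweak_derive (- 2^-1) 2^-1 X X1 -> cweak_derive (- 2^-1) 2^-1 X1 X2 ->
  continuous Y1 -> (forall y : R, is_derive y 1 Y (Y1 y)) ->
  weak_derive 0 1 Y Y1 -> weak_derive 0 1 Y1 Y2 ->
  X (- 2^-1) = 0 -> X 2^-1 = 0 -> Y 0 = 0 -> Y 1 = 0 ->
  dirichlet_laplacian (tensor X Y) (fun p => - (tensor X2 Y p + tensor X Y2 p)).
Proof.
move=> dX [cXr cXi] aX aX1 cY1 dY aY aY1 Xl Xr Yl Yr.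
exists (tensor X1 Y), (tensor X Y1), (tensor X2 Y), (tensor X1 Y1), (tensor X1 Y1),
  (tensor X Y2); split.
- by apply: weak_H2_tensor => //; first [exact: compatible_x_compact|exact: compatible_y_compact].
- by apply: H10_tensor => // x; have [] := dX x.
- exact: L2_laplacian_tensor aX aX1 aY aY1.
- exact: aeW.
Qed.

Lemma tensor_neumann (R : realType) (X X1 X2 : R -> R[i]) (Y Y1 Y2 : R -> R) :
  cweak_derive (- 2^-1) 2^-1 X X1 -> cweak_derive (- 2^-1) 2^-1 X1 X2 ->
  weak_derive 0 1 Y Y1 -> weak_derive 0 1 Y1 Y2 ->
  X1 (- 2^-1) = 0 -> X1 2^-1 = 0 -> Y1 0 = 0 -> Y1 1 = 0 ->
  neumann_laplacian (tensor X Y) (fun p => - (tensor X2 Y p + tensor X Y2 p)).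
Proof.
move=> aX aX1 aY aY1 Xl Xr Yl Yr.
exists (tensor X1 Y), (tensor X Y1), (tensor X2 Y), (tensor X1 Y1), (tensor X1 Y1),
  (tensor X Y2); split.
- by apply: weak_H2_tensor => //; first [exact: compatible_x_compact|exact: compatible_y_compact].
- exact: neumann_tensor.
- exact: L2_laplacian_tensor aX aX1 aY aY1.
- exact: aeW.
Qed.

Lemma tensor_torus (R : realType) (X X1 X2 : R -> R[i]) (Y Y1 Y2 : R -> R) :
  cweak_derive (- 2^-1) 2^-1 X X1 -> cweak_derive (- 2^-1) 2^-1 X1 X2 ->
  weak_derive 0 1 Y Y1 -> weak_derive 0 1 Y1 Y2 ->
  X (- 2^-1) = X 2^-1 -> X1 (- 2^-1) = X1 2^-1 -> Y 0 = Y 1 -> Y1 0 = Y1 1 ->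
  torus_laplacian (tensor X Y) (fun p => - (tensor X2 Y p + tensor X Y2 p)).
Proof.
move=> aX aX1 aY aY1 XE X1E YE Y1E.
exists (tensor X1 Y), (tensor X Y1), (tensor X2 Y), (tensor X1 Y1), (tensor X1 Y1),
  (tensor X Y2); split.
- by apply: weak_H2_tensor => //; first [exact: compatible_x_torus|exact: compatible_y_torus].
- exact: L2_laplacian_tensor aX aX1 aY aY1.
- exact: aeW.
Qed.

Theorem corollary2p8 (R : realType) (sigma B eps : R)
    (hsigma0 : 0 < sigma) (hsigma1 : sigma < 2^-1)
    (hB : 0 < B) (heps : 0 < eps) :
  (forall S : operator R, is_sqrt (@torus_laplacian R) S ->
     ~ stable_at_rate (@torus_laplacian R) S (damping sigma B)
         (fun t => (t `^ (2 / 3 + eps))^-1)) /\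
  (forall S : operator R, is_sqrt (@dirichlet_laplacian R) S ->
     ~ stable_at_rate (@dirichlet_laplacian R) S (damping sigma B)
         (fun t => (t `^ (2 / 3 + eps))^-1)) /\
  (forall S : operator R, is_sqrt (@neumann_laplacian R) S ->
     ~ stable_at_rate (@neumann_laplacian R) S (damping sigma B)
         (fun t => (t `^ (2 / 3 + eps))^-1)).
Proof.
(* This provides an interior point where the factor in y does not vanish: nu y0 is pi for the cosine
   (c = 2) and pi / 2 for the sine (c = 4). *)
have y01 n (c : R) : 2 <= c -> 0 < (c * n.+1%:R)^-1 < 1.
  move=> c2; have n1 : 1 <= n.+1%:R :> R by rewrite ler1n.
  have cn : 2 <= c * n.+1%:R by nra.
  have cn0 : 0 < c * n.+1%:R by lra.
  by rewrite invr_gt0 cn0 invf_lt1//; lra.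
have cosc (nu : R) : continuous (fun y => cos (nu * y)).
  exact: is_derive_continuous (is_derive_cosM nu).
have sinc (nu : R) : continuous (fun y => sin (nu * y)).
  exact: is_derive_continuous (is_derive_sinM nu).
have cospi_ n : cos (2 * pi * n.+1%:R * (2 * n.+1%:R)^-1) != 0 :> R.
  rewrite (_ : _ * _^-1 = pi) ?cospi ?oppr_eq0 ?oner_eq0//.
  have : n.+1%:R != 0 :> R by rewrite pnatr_eq0.
  by move: n.+1%:R => x x0; field.
split; [|split] => S sq.
(* On the torus, tau = 1 makes X1 vanish at both ends while X takes the same value there: the
   profile and its derivative are periodic. *)
- apply: (not_stable_of_transverse_modes (tau := 1) hsigma0 hsigma1 hB heps) sq.
  move=> n X X1 X2 D E dX cX1 aX aX1 Xl Xr X1l X1r nu.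
  have [a1 a2 _ _] := weak_derive_trig nu; have [c1 s1] := cos_sin_2pin R n.+1.
  exists (fun y => cos (nu * y)), (2 * n.+1%:R)^-1; split; [exact: cosc|exact: y01|exact: cospi_|].
  apply: (tensor_torus aX aX1 a1 a2); rewrite ?Xl ?Xr ?X1l ?X1r ?subrr ?mulr0 ?mulr1 //.
    by rewrite cos0 c1.
  by rewrite sin0 s1.
(* For Dirichlet, X vanishes at both ends, and the sine vanishes at y = 1 because nu is a multiple
   of 2 pi. *)
- apply: (not_stable_of_transverse_modes (tau := -1) hsigma0 hsigma1 hB heps) sq.
  move=> n X X1 X2 D E dX cX1 aX aX1 Xl Xr X1l X1r nu.
  have [_ _ a1 a2] := weak_derive_trig nu; have [c1 s1] := cos_sin_2pin R n.+1.
  exists (fun y => sin (nu * y)), (4 * n.+1%:R)^-1; split; [exact: sinc|by apply: y01; lra| |].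
    rewrite (_ : nu * _ = pi / 2) ?sin_pihalf ?oner_eq0//.
    have : n.+1%:R != 0 :> R by rewrite pnatr_eq0.
    by rewrite /nu; move: n.+1%:R => x x0; field.
  apply: (tensor_dirichlet dX cX1 aX aX1 _ (is_derive_sinM nu) a1 a2).
  + by move=> y; apply: cvgM; [exact: cvg_cst|exact: cosc].
  + by rewrite Xl subrr mulr0.
  + by rewrite Xr subrr mulr0.
  + by rewrite mulr0 sin0.
  + by rewrite mulr1 s1.
- apply: (not_stable_of_transverse_modes (tau := 1) hsigma0 hsigma1 hB heps) sq.
  move=> n X X1 X2 D E dX cX1 aX aX1 Xl Xr X1l X1r nu.
  have [a1 a2 _ _] := weak_derive_trig nu; have [c1 s1] := cos_sin_2pin R n.+1.
  exists (fun y => cos (nu * y)), (2 * n.+1%:R)^-1; split; [exact: cosc|exact: y01|exact: cospi_|].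
  apply: (tensor_neumann aX aX1 a1 a2).
  + by rewrite X1l subrr mulr0.
  + by rewrite X1r subrr mulr0.
  + by rewrite mulr0 sin0 mulr0.
  + by rewrite mulr1 s1 mulr0.
Qed.
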